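(* Let $n\ge 1$ be an integer, $L\ge 1$ an odd integer, $N:=L^n$, and identify $\mathbb{R}^{\mathbb{T}^n_L}\cong\mathbb{R}^N$. Let $\mathring H:=\{\Xi\in\mathbb{R}^{N}:\sum_{v\in\mathbb{T}^n_L}\Xi_v=0\}$ and let $\mathcal{L}^{N-1}_{\mathring H}$ be the $(N-1)$-dimensional Lebesgue measure on $\mathring H$. Let $\boldsymbol\nu$ be the measure on $\mathring H$ (regarded also as a measure on $\mathbb{R}^N$ supported on $\mathring H$) given by $$d\boldsymbol\nu(h)=c_n\,e^{-\frac{a_n}{2N}\|(-\Delta_L)^{n/4}h\|^2}\,d\mathcal{L}^{N-1}_{\mathring H}(h),\qquad c_n:=\Big(\frac{a_n}{2\pi N}\Big)^{\frac{N-1}{2}}\prod_{z\in\mathbb{Z}^n_L\setminus\{0\}}\Big(4L^2\sum_{k=1}^n\sin^2(\pi z_k/L)\Big)^{n/4}.$$ Then $\boldsymbol\nu$ is a probability measure, and it is the distribution of the polyharmonic Gaussian field on the discrete torus $\mathbb{T}^n_L$. Furthermore, with $\mathring T:\mathring H\to\mathring H$, $\mathring T h:=\sqrt{a_n}\,(-\Delta_L)^{n/4}h$, one has $\mathring T_*\boldsymbol\nu=\mathring{\mathbf P}$, where $\mathring{\mathbf P}$ is the law of the grounded white noise, i.e. $$d\mathring{\mathbf P}(\Xi)=\frac{1}{(2\pi N)^{\frac{N-1}{2}}}\,e^{-\frac{1}{2N}\|\Xi\|^2}\,d\mathcal{L}^{N-1}_{\mathring H}(\Xi).$$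
   Context: $a_n:=\frac{2}{\Gamma(n/2)(4\pi)^{n/2}}$. $\mathbb{Z}^n_L:=\{z\in\mathbb{Z}^n:\max_k|z_k|<L/2\}$. The discrete torus is $\mathbb{T}^n_L:=(\frac1L\mathbb{Z})^n/\mathbb{Z}^n$, with $N=L^n$ points. $\|\cdot\|$ is the Euclidean norm on $\mathbb{R}^N$. The discrete Laplacian is $\Delta_Lf(v):=L^2\sum_{u\sim v}[f(u)-f(v)]$, where $u\sim v$ means that $u,v$ are at torus distance $\frac1L$. The functions $\Phi_z(v)=e^{2\pi i z\cdot v}$, $z\in\mathbb{Z}^n_L$, are eigenfunctions of $-\Delta_L$ with eigenvalues $\lambda_{L,z}:=4L^2\sum_{k=1}^n\sin^2(\pi z_k/L)$, and $(-\Delta_L)^{n/4}$ is defined by the spectral calculus. A polyharmonic Gaussian field on $\mathbb{T}^n_L$ is a centered Gaussian field $h_L=(h_L(v))_{v\in\mathbb{T}^n_L}$ with covariance $\mathbf E[h_L(v)h_L(u)]=k_L(v,u):=\frac1{a_n}\sum_{z\in\mathbb{Z}^n_L\setminus\{0\}}\lambda_{L,z}^{-n/2}\cos(2\pi z\cdot(v-u))$. *)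

(* Defs.v *)
From HB Require Import structures.
From mathcomp Require Import all_boot all_order all_algebra.
From mathcomp Require Import all_classical all_reals all_analysis.

Set Implicit Arguments.
Unset Strict Implicit.
Unset Printing Implicit Defensive.
Import Order.TTheory GRing.Theory Num.Theory.
Import numFieldNormedType.Exports.

Local Open Scope classical_set_scope.
Local Open Scope ring_scope.

(* [rvec R I] is the Euclidean space R^I, as a vector space and as a
   measurable space (the sigma-algebra generated by the coordinates, which for
   finite I is the Borel one). *)
Definition rvec (R : realType) (I : finType) : Type := I -> R.

HB.instance Definition _ (R : realType) (I : finType) :=
  Pointed.copy (rvec R I) (I -> R).
HB.instance Definition _ (R : realType) (I : finType) :=
  GRing.Lmodule.copy (rvec R I) (I -> R).

Definition cylinders (R : realType) (I : finType) : set (set (rvec R I)) :=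
  \bigcup_(i in [set: I])
    preimage_set_system setT (fun h : rvec R I => h i : measurableTypeR R)
      measurable.
Arguments cylinders : clear implicits.

Definition rvec_display : measure_display.
Proof. exact: default_measure_display. Qed.

Section rvec_measurable.
Variables (R : realType) (I : finType).

Let rvec_set0 : <<s cylinders R I >> set0.
Proof. exact: sigma_algebra0. Qed.

Let rvec_setC A : <<s cylinders R I >> A -> <<s cylinders R I >> (~` A).
Proof. exact: sigma_algebraC. Qed.

Let rvec_bigcup (F : (set (rvec R I))^nat) :
  (forall i, <<s cylinders R I >> (F i)) ->
  <<s cylinders R I >> (\bigcup_i F i).
Proof. exact: sigma_algebra_bigcup. Qed.

HB.instance Definition _ := @isMeasurable.Build rvec_display (rvec R I)
  <<s cylinders R I >> rvec_set0 rvec_setC rvec_bigcup.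

End rvec_measurable.

Definition dotv (R : realType) (I : finType) (x y : rvec R I) : R :=
  \sum_i x i * y i.

Definition enorm (R : realType) (I : finType) (x : rvec R I) : R :=
  Num.sqrt (\sum_i x i ^+ 2).

Definition Gamma (R : realType) (x : R) : R :=
  \int[@lebesgue_measure R]_(t in `]0, +oo[) (t `^ (x - 1) * expR (- t)).

Definition a_ (R : realType) (n : nat) : R :=
  2 / (Gamma (n%:R / 2) * (4 * pi) `^ (n%:R / 2)).

(* The point [v] of (Z/L)^n / Z^n is represented by the coordinates
   v_k / L in [0, 1). *)
Definition torus (n L : nat) : finType := {ffun 'I_n -> 'I_L}.

Definition tcoord (R : realType) (n L : nat) (v : torus n L) : rvec R 'I_n :=
  fun k => (v k)%:R / L%:R.

Definition torus_dist (R : realType) (n L : nat) (u v : torus n L) : R :=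
  inf [set enorm (fun k => tcoord R u k - tcoord R v k + (m k)%:~R : R)
      | m in [set: {ffun 'I_n -> int}]].

Definition adjacent (R : realType) (n L : nat) (u v : torus n L) : bool :=
  torus_dist R u v == L%:R^-1.

Definition laplacian (R : realType) (n L : nat)
    (f : rvec R (torus n L)) : rvec R (torus n L) :=
  fun v => L%:R ^+ 2 * \sum_(u | adjacent R u v) (f u - f v).

(* Spectral calculus g(A): the linear operator acting as g(lam) on every
   eigenspace ker(A - lam). It exists and is unique whenever A is
   diagonalizable, in particular for the symmetric operator [- laplacian]. *)
Definition spectral_calculus (R : realType) (I : finType)
    (A : rvec R I -> rvec R I) (g : R -> R) : rvec R I -> rvec R I :=
  get [set B : rvec R I -> rvec R I | linear B /\
    forall (lam : R) (phi : rvec R I),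
      A phi = lam *: phi -> B phi = g lam *: phi].

Definition frac_laplacian (R : realType) (n L : nat) (s : R) :
    rvec R (torus n L) -> rvec R (torus n L) :=
  spectral_calculus (fun f => - laplacian f) (fun lam => lam `^ s).

Definition ZL (n L : nat) : set {ffun 'I_n -> int} :=
  [set z | forall k, (2 * absz (z k) < L)%N].
Arguments ZL : clear implicits.

Definition lambda (R : realType) (n L : nat) (z : {ffun 'I_n -> int}) : R :=
  4 * L%:R ^+ 2 * \sum_(k < n) sin (pi * (z k)%:~R / L%:R) ^+ 2.

Definition kL (R : realType) (n L : nat) (v u : torus n L) : R :=
  (a_ R n)^-1 * \sum_(z \in ZL n L `\ 0)
    lambda R L z `^ (- (n%:R / 2)) *
    cos (2 * pi * \sum_(k < n) (z k)%:~R * (tcoord R v k - tcoord R u k)).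

(* [normal_prob m 0] is not the Dirac mass at m (the library takes an arbitrary
   probability there), so the degenerate case is treated apart. *)
Definition gaussian_law (R : realType) (m s : R)
    (A : set (measurableTypeR R)) : \bar R :=
  if s == 0 then \d_m A else normal_prob m s A.

Definition gaussian_field (R : realType) (I : finType)
    (d : measure_display) (W : measurableType d) (P : probability W R)
    (X : {RV P >-> rvec R I}) : Prop :=
  forall c : rvec R I, exists m s : R, 0 <= s /\
    forall A : set (measurableTypeR R), measurable A ->
      P [set w | A (dotv c (X w))] = gaussian_law m s A.

Definition polyharmonic_field (R : realType) (n L : nat)
    (d : measure_display) (W : measurableType d) (P : probability W R)
    (X : {RV P >-> rvec R (torus n L)}) : Prop :=
  [/\ gaussian_field X,
      forall v, ('E_P[fun w => X w v] = 0)%E &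
      forall v u, ('E_P[fun w => (X w v * X w u)%R] = (kL R v u)%:E)%E].

(* Lebesgue measure on R^d (the unit mass for d = 0). *)
Fixpoint lebesgue_tuple (R : realType) (d : nat) {struct d} :
    set (d.-tuple (measurableTypeR R)) -> \bar R :=
  match d with
  | 0 => dirac [tuple]
  | d'.+1 => pushforward
      (product_measure1 (@lebesgue_measure R) (@lebesgue_tuple R d'))
      (fun p : measurableTypeR R * d'.-tuple (measurableTypeR R) =>
         [tuple of p.1 :: p.2])
  end.
Arguments lebesgue_tuple : clear implicits.

Definition grounded (R : realType) (n L : nat) : set (rvec R (torus n L)) :=
  [set h | \sum_v h v = 0].
Arguments grounded : clear implicits.

(* As [grounded R n L] has dimension L^n - 1, an orthonormal family of this
   size in it is a basis. *)
Definition grounded_onb (R : realType) (n L : nat) :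
    set ('I_(L ^ n).-1 -> rvec R (torus n L)) :=
  [set e | (forall i, grounded R n L (e i)) /\
           forall i j, dotv (e i) (e j) = (i == j)%:R].
Arguments grounded_onb : clear implicits.

(* The (L^n - 1)-dimensional Lebesgue measure on [grounded R n L], viewed on the
   ambient space: the image of the Lebesgue measure on R^(L^n - 1) under the
   coordinates in an orthonormal basis. By rotation invariance it does not
   depend on the basis. *)
Definition lebesgue_grounded (R : realType) (n L : nat) :
    set (rvec R (torus n L)) -> \bar R :=
  let e := get (grounded_onb R n L) in
  pushforward (lebesgue_tuple R (L ^ n).-1)
    (fun t => \sum_i (tnth t i : R) *: e i : rvec R (torus n L)).
Arguments lebesgue_grounded : clear implicits.

Definition c_ (R : realType) (n L : nat) : R :=
  (a_ R n / (2 * pi * (L ^ n)%:R)) `^ ((L ^ n).-1%:R / 2) *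
  \big[*%R/1]_(z \in ZL n L `\ 0) lambda R L z `^ (n%:R / 4).

Definition nu (R : realType) (n L : nat)
    (A : set (rvec R (torus n L))) : \bar R :=
  (\int[lebesgue_grounded R n L]_(h in A)
    (c_ R n L * expR (- (a_ R n / (2 * (L ^ n)%:R)) *
                      enorm (frac_laplacian (n%:R / 4) h) ^+ 2))%:E)%E.
Arguments nu : clear implicits.

Definition grounded_white_noise (R : realType) (n L : nat)
    (A : set (rvec R (torus n L))) : \bar R :=
  (\int[lebesgue_grounded R n L]_(h in A)
    (((2 * pi * (L ^ n)%:R) `^ ((L ^ n).-1%:R / 2))^-1 *
       expR (- (1 / (2 * (L ^ n)%:R)) * enorm h ^+ 2))%:E)%E.
Arguments grounded_white_noise : clear implicits.

Definition Tmap (R : realType) (n L : nat)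
    (h : rvec R (torus n L)) : rvec R (torus n L) :=
  Num.sqrt (a_ R n) *: frac_laplacian (n%:R / 4) h.
Arguments Tmap : clear implicits.

(* Main.v *)
From HB Require Import structures.
Require Import Defs.
From mathcomp Require Import all_boot all_order all_algebra.
From mathcomp Require Import all_classical all_reals all_analysis.
From mathcomp Require Import measurable_realfun zify ring lra.

(* The real functions cos(2 pi z.v) + sin(2 pi z.v), z in (Z/L)^n, form an
   orthogonal basis of eigenfunctions of the discrete Laplacian, so (- Delta_L)^s
   acts diagonally on them and k_L is diagonal in them. In the coordinates of
   this basis nu is a product of centred normal laws, of variances
   N / (a_n lambda_z^(n/2)), c_n being the product of their normalizing
   constants. Every linear form of a product of normal laws is normal, so each
   claim reduces to comparing laws all of whose linear forms agree; such laws
   are equal by the Cramer-Wold theorem, which is proved by approximating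
   indicators of half-lines by trigonometric polynomials. Cramer-Wold applied to
   the standard Gaussian also shows that Lebesgue measure on the grounded fields
   does not depend on the orthonormal basis, since the Gaussian density is a
   function of the norm. *)

Set Implicit Arguments.
Unset Strict Implicit.
Unset Printing Implicit Defensive.
Import Order.TTheory GRing.Theory Num.Theory.
Import numFieldNormedType.Exports.

Local Open Scope classical_set_scope.
Local Open Scope ring_scope.

(** * The Cramer-Wold theorem *)

(** Two objects are defined by choice: [lebesgue_grounded] uses some orthonormal basis,
    [frac_laplacian] some operator. Nothing can be computed until the first is rewritten in the
    Hartley basis and the second as a Hartley multiplier. For the first, Cramer-Wold speaks of
    probabilities only, while Lebesgue measure is not one; multiplying and dividing by a Gaussian
    density turns the comparison into one of probability laws. In Cramer-Wold, the cosine of a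
    linear form depends on that form alone, so its integral is known. A product of cosines is a sum
    of cosines; hence indicators of half-spaces can be inserted one coordinate at a time, provided a
    free cosine factor is carried along for the coordinates still to come. Oddness of L enters
    twice: it excludes L = 2, where the two steps along an axis coincide, and it excludes residues w
    with 2 w = L, which have no representative in [ZL]. *)

Lemma ler_1BX (R : realType) (y : R) (k : nat) :
  0 <= y <= 1 -> 1 - k%:R * y <= (1 - y) ^+ k.
Proof.
move=> /andP[y0 y1]; elim: k => [|k ih]; first by rewrite mul0r subr0 expr0.
rewrite exprS; apply: (@le_trans _ _ ((1 - y) * (1 - k%:R * y))); last first.
  by rewrite ler_wpM2l// subr_ge0.
by rewrite -natr1; have := ler0n R k; nra.
Qed.

(** The step is (1 - y)(1 + (k + 1) y) <= 1 + k y. With Bernoulli's bound above, this controls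
    [(1 - y) ^+ k] from both sides by the size of [k%:R * y] alone. *)
Lemma ler_1BX_inv (R : realType) (y : R) (k : nat) :
  0 <= y <= 1 -> (1 - y) ^+ k * (1 + k%:R * y) <= 1.
Proof.
move=> /andP[y0 y1]; elim: k => [|k ih]; first by rewrite expr0 mul0r addr0 mulr1.
apply: le_trans ih; rewrite exprSr -mulrA ler_wpM2l ?exprn_ge0 ?subr_ge0//.
by rewrite -natr1; have := ler0n R k; nra.
Qed.

(** 1 - q^n is 1 - q times a sum of n powers of q, each at least q^n. *)
Lemma natr_expr_bound (R : realType) (q : R) (n : nat) :
  0 <= q <= 1 -> n%:R * q ^+ n * (1 - q) <= 1 - q ^+ n.
Proof.
move=> /andP[q0 q1]; elim: n => [|n ih]; first by rewrite !mul0r expr0 subrr.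
have h : 0 <= (1 - q) * (1 - q ^+ n.+1).
  by rewrite mulr_ge0// subr_ge0// exprn_ile1.
have {ih} : q * (n%:R * q ^+ n * (1 - q)) <= q * (1 - q ^+ n).
  by rewrite ler_wpM2l.
by rewrite -natr1 !exprS in h *; nra.
Qed.

Lemma cvg_natr_expr (R : realType) (r : R) :
  0 <= r < 1 -> n%:R * r ^+ n @[n --> \oo] --> (0 : R).
Proof.
(* In r^n = q^n q^n one factor absorbs n, and the other tends to 0. *)
move=> /andP[r0 r1]; pose q := Num.sqrt r.
have q0 : 0 <= q by exact: sqrtr_ge0.
have q1 : q < 1 by rewrite -sqrtr1 ltr_sqrt.
have rE : r = q ^+ 2 by rewrite sqr_sqrtr.
have cv : (1 - q)^-1 * q ^+ n @[n --> \oo] --> (0 : R).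
  by rewrite -[0](mulr0 (1 - q)^-1); apply: cvgMr; apply: cvg_expr; rewrite ger0_norm.
apply: (@squeeze_cvgr _ _ _ _ (fun=> 0) (fun n => (1 - q)^-1 * q ^+ n)) => //.
- apply: nearW => n; rewrite mulr_ge0 ?exprn_ge0//=.
  rewrite rE exprAC expr2 mulrA ler_wpM2r ?exprn_ge0//.
  rewrite -[leRHS]mul1r ler_pdivlMr ?subr_gt0//.
  apply: le_trans (natr_expr_bound _ _) _; first by rewrite q0 ltW.
  by rewrite gerBl exprn_ge0.
- exact: cvg_cst.
Qed.

(* The exponent [m * 2 ^ m] puts the threshold at [w = 1/2], where the limit is
   still 0. *)
Lemma cvg_threshold (R : realType) (w : R) : 0 <= w <= 1 ->
  (1 - w ^+ m) ^+ (m * 2 ^ m)%N @[m --> \oo] --> ((w < 2^-1)%R%:R : R).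
Proof.
move=> /andP[w0 w1].
have wm m : 0 <= w ^+ m <= 1 by rewrite exprn_ge0//= exprn_ile1.
have wmE m : (m * 2 ^ m)%N%:R * w ^+ m = m%:R * (2 * w) ^+ m :> R.
  by rewrite natrM natrX exprMn mulrA.
have ge0 m : 0 <= 1 - w ^+ m by rewrite subr_ge0; case/andP: (wm m).
have [w2|w2] := ltP w 2^-1.
- have cv : m%:R * (2 * w) ^+ m @[m --> \oo] --> (0 : R).
    by apply: cvg_natr_expr; apply/andP; split; lra.
  apply: (@squeeze_cvgr _ _ _ _ (fun m => 1 - m%:R * (2 * w) ^+ m) (fun=> 1)).
  + apply: nearW => m; rewrite -wmE ler_1BX//= exprn_ile1// gerBl.
    by case/andP: (wm m).
  + by rewrite -[X in _ --> X]subr0; apply: cvgB => //; exact: cvg_cst.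
  + exact: cvg_cst.
- apply: (@squeeze_cvgr _ _ _ _ (fun=> 0) (fun m => m.+1%:R^-1)).
  + apply: nearW => m; rewrite exprn_ge0//=.
    rewrite -[leRHS]mul1r ler_pdivlMr ?ltr0Sn//.
    apply: le_trans (ler_1BX_inv (m * 2 ^ m)%N (wm m)).
    rewrite ler_wpM2l ?exprn_ge0// wmE -natr1 addrC lerD2l.
    by rewrite ler_peMr// exprn_ege1//; lra.
  + exact: cvg_cst.
  + exact: cvg_harmonic.
Qed.

Lemma measurable_rvec_coord (R : realType) (I : finType) (i : I) :
  measurable_fun [set: rvec R I] (fun h : rvec R I => h i : measurableTypeR R).
Proof.
move=> _ A mA; rewrite setTI; apply: sub_sigma_algebra.
by exists i => //; exists A => //; rewrite setTI.
Qed.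

Lemma measurable_rvec (R : realType) (I : finType) d (T : measurableType d)
    (f : T -> rvec R I) :
  (forall i, measurable_fun [set: T] (fun x => f x i : measurableTypeR R)) ->
  measurable_fun [set: T] f.
Proof.
move=> mf; apply: (measurability (cylinders R I)) => //.
move=> _ [_ [i _ [A mA <-]] <-]; rewrite !setTI.
by have := mf i measurableT _ mA; rewrite setTI.
Qed.

Lemma measurable_dotv (R : realType) (I : finType) (c : rvec R I) :
  measurable_fun [set: rvec R I] (fun h => dotv c h : measurableTypeR R).
Proof.
apply: measurable_sum => i; apply: measurable_funM => //.
exact: measurable_rvec_coord.
Qed.

Section cramer_wold.
Variables (R : realType) (I : finType) (P Q : probability (rvec R I) R).

(** Such functions form a vector space closed under uniformly bounded pointwise limits. These two
    closure properties are all that the approximation uses. *)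
Let agree (f : rvec R I -> R) := [/\ measurable_fun setT f,
  exists M : R, forall x, `|f x| <= M &
  (\int[P]_x (f x)%:E = \int[Q]_x (f x)%:E)%E].

Let bounded_integrable (mu : probability (rvec R I) R) (f : rvec R I -> R) :
  measurable_fun setT f -> (exists M : R, forall x, `|f x| <= M) ->
  mu.-integrable setT (EFin \o f).
Proof.
move=> mf [M fM]; apply: measurable_bounded_integrable => //.
  by rewrite ltey_eq fin_num_measure.
exists M; split; first exact: num_real.
by move=> x Mx y _ /=; rewrite (le_trans (fM y))// ltW.
Qed.

Let agreeDZ f g k : agree f -> agree g -> agree (fun x => f x + k * g x).
Proof.
move=> [mf bf fE] [mg bg gE].
have mkg : measurable_fun setT (fun x => k * g x) by exact: measurable_funM.
have bkg : exists M : R, forall x, `|k * g x| <= M.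
  by case: bg => M gM; exists (`|k| * M) => x; rewrite normrM ler_wpM2l.
split; first exact: measurable_funD.
  case: bf bkg => [M fM] [N gN]; exists (M + N) => x.
  by rewrite (le_trans (ler_normD _ _))// lerD.
under eq_integral do rewrite EFinD EFinM.
under [RHS]eq_integral do rewrite EFinD EFinM.
rewrite !integralD//=; try exact: bounded_integrable;
  try (apply: integrableZl => //; exact: bounded_integrable).
by rewrite !integralZl//; try exact: bounded_integrable; rewrite fE gE.
Qed.

Let agree_lim (f : (rvec R I -> R)^nat) g : (forall n, agree (f n)) ->
  (exists M, forall n x, `|f n x| <= M) ->
  (forall x, f n x @[n --> \oo] --> g x) -> agree g.
Proof.
move=> af [M fM] fg.
have mf n : measurable_fun setT (f n) by case: (af n).
have mg : measurable_fun setT g by apply: (measurable_fun_cvg mf) => x _; exact: fg.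
have lim (mu : probability (rvec R I) R) :
    (\int[mu]_x (f n x)%:E @[n --> \oo] --> \int[mu]_x (g x)%:E)%E.
  have [] := @dominated_convergence _ _ _ mu _ measurableT
     (fun n x => (f n x)%:E) (fun x => (g x)%:E) (fun=> M%:E) => //.
  - by move=> n; exact/measurable_EFinP.
  - exact/measurable_EFinP.
  - by apply: aeW => x _; apply: cvg_EFin; [exact: nearW|exact: fg].
  - exact: finite_measure_integrable_cst.
  - by apply: aeW => x n _; rewrite lee_fin.
split=> //.
  exists M => x; have cn : `|f n x| @[n --> \oo] --> `|g x| by exact: cvg_norm.
  by rewrite -(cvg_lim _ cn)//; apply: limr_le; [apply/cvg_ex; exists (`|g x|)|exact: nearW].
have e n : (\int[P]_x (f n x)%:E = \int[Q]_x (f n x)%:E)%E by case: (af n).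
have lP := lim P; rewrite (funext e) in lP.
exact: (cvg_unique _ lP (lim Q)).
Qed.

Section one_coordinate.
Variables (H : rvec R I -> R) (j : I).
Hypothesis agreeH : forall c th, agree (fun x => H x * cos (dotv c x + th)).

(** Quantifying over [c] and [th] makes this class stable under multiplication of F by a cosine of
    the coordinate: the product of the two cosines is a half-sum of cosines whose [c] is shifted
    along [j]. *)
Let V (F : R -> R) :=
  forall c th, agree (fun x => H x * F (x j) * cos (dotv c x + th)).

Let VDZ F G k : V F -> V G -> V (fun y => F y + k * G y).
Proof.
move=> VF VG c th; have := agreeDZ k (VF c th) (VG c th).
by congr agree; apply/funext => x; ring.
Qed.

Let Vcos F om ph : V F -> V (fun y => F y * cos (om * y + ph)).
Proof.
move=> VF c th; pose e : rvec R I := fun i => om * (i == j)%:R.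
have dotvD x s : dotv (fun i => c i + s * e i) x = dotv c x + s * om * x j.
  rewrite /dotv; under eq_bigr do rewrite mulrDl.
  rewrite big_split/=; congr (_ + _); rewrite (bigD1 j)//= big1 => [|i ij].
    by rewrite /e eqxx mulr1 addr0.
  by rewrite /e (negbTE ij) !mulr0 mul0r.
have h1 := VF (fun i => c i + 1 * e i) (th + ph).
have h2 := VF (fun i => c i + (-1) * e i) (th - ph).
have z : agree (fun x => 0).
  split; [exact: measurable_cst|by exists 0 => x; rewrite normr0|].
  by rewrite !integral0.
have := agreeDZ 2^-1 (agreeDZ 2^-1 z h1) h2; congr agree; apply/funext => x.
rewrite !dotvD.
have -> : dotv c x + 1 * om * x j + (th + ph) = (dotv c x + th) + (om * x j + ph).
  by ring.
have -> : dotv c x + -1 * om * x j + (th - ph) = (dotv c x + th) - (om * x j + ph).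
  by ring.
by rewrite cosD cosB; field.
Qed.

Let V_lim (F : (R -> R)^nat) G : (forall n, V (F n)) ->
  (exists M, forall n y, `|F n y| <= M) ->
  (forall y, F n y @[n --> \oo] --> G y) -> V G.
Proof.
move=> VF [M FM] FG c th.
(* At [c = 0], [th = 0] the cosine is 1, so this bound is a bound on [H] itself. *)
case: (agreeH 0 0) => _ [N HN] _.
have HN' x : `|H x| <= N.
  have := HN x; rewrite /dotv big1 => [|i _]; last by rewrite mul0r.
  by rewrite addr0 cos0 mulr1.
apply: (agree_lim (fun n => VF n c th)).
  exists (N * M * 1) => n x; rewrite !normrM ler_pM//.
    by rewrite ler_pM.
  by rewrite ler_norml cos_geN1 cos_le1.
by move=> x; apply: cvgMl; apply: cvgMr; exact: FG.
Qed.

(** [w p y < 2^-1] means that a sine of period 2 pi (p + 1), vanishing at a, is negative at y.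
    Letting m grow in the powers of [w] gives the indicator of this periodic set; letting then p
    grow pushes the other periods to infinity and leaves the half-line. *)
Let Vlt a : V (fun y => (y < a)%R%:R).
Proof.
pose w (p : nat) (y : R) : R := (1 + sin ((y - a) / p.+1%:R)) / 2.
have w01 p y : 0 <= w p y <= 1.
  rewrite /w; have := sin_geN1 ((y - a) / p.+1%:R).
  by have := sin_le1 ((y - a) / p.+1%:R); lra.
have Vw p F : V F -> V (fun y => F y * w p y).
  (* The phase pi / 2 turns the cosine into minus the sine, and F / 2 is obtained as F - F / 2,
     [VDZ] producing only combinations F + k G. *)
  move=> VF; have := VDZ (- 2^-1) (VDZ (- 2^-1) VF VF)
    (Vcos p.+1%:R^-1 (- (a / p.+1%:R) + pi / 2) VF).
  congr V; apply/funext => y; rewrite addrA cosDpihalf /w.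
  by rewrite (_ : p.+1%:R^-1 * y + - _ = (y - a) / p.+1%:R); field.
have VwX p F m : V F -> V (fun y => F y * w p y ^+ m).
  move=> VF; elim: m => [|m ih].
    by have := VF; congr V; apply/funext => y; rewrite expr0 mulr1.
  by have := Vw p _ ih; congr V; apply/funext => y; rewrite exprSr mulrA.
have V1 : V (fun=> 1).
  by move=> c th; have := agreeH c th; congr agree; apply/funext => x; rewrite mulr1.
have Vpow p m k : V (fun y => (1 - w p y ^+ m) ^+ k).
  elim: k => [|k ih]; first by have := V1; congr V; apply/funext.
  have := VDZ (-1) ih (VwX p _ m ih); congr V; apply/funext => y.
  by rewrite exprSr; ring.
have Vhalf p : V (fun y => (w p y < 2^-1)%R%:R).
  apply: (V_lim (fun m => Vpow p m (m * 2 ^ m)%N)); last first.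
    by move=> y; exact: cvg_threshold.
  exists 1 => m y; rewrite normrX exprn_ile1// ger0_norm ?subr_ge0 ?gerBl.
    by case/andP: (w01 p y) => *; exact: exprn_ge0.
  by case/andP: (w01 p y) => *; exact: exprn_ile1.
apply: (V_lim Vhalf); first by exists 1 => p y; case: (_ < _); rewrite ?normr1 ?normr0.
move=> y; apply: cvg_near_cst.
have cz : (y - a) / p.+1%:R @[p --> \oo] --> (0 : R).
  rewrite -[X in _ --> X](mulr0 (y - a)).
  by apply: cvgMr; exact: cvg_harmonic.
(* Once the argument of the sine is below 1 < pi in absolute value, the sine has the sign of y -
   a. *)
near=> p; congr (nat_of_bool _)%:R.
have small : `|(y - a) / p.+1%:R| < 1.
  near: p; move/cvgrPdist_lt : cz => /(_ 1 ltr01).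
  by apply: filterS => p; rewrite sub0r normrN.
have := @pi_ge2 R; rewrite /w; set t := (y - a) / _ in small * => pi2.
have tE : y - a = t * p.+1%:R by rewrite /t divfK.
have p0 : 0 < p.+1%:R :> R by [].
move: small; rewrite ltr_norml => /andP[tl tu].
have [ya|ya] := ltP y a.
- have t0 : 0 < - t by rewrite /t -mulNr divr_gt0//; lra.
  have : 0 < sin (- t) by apply: sin_gt0_pi; rewrite t0; lra.
  by rewrite sinN => h; lra.
- have t0 : 0 <= t by rewrite /t divr_ge0//; lra.
  have h : 0 <= sin t by apply: sin_ge0_pi; rewrite ?in_itv/= t0; lra.
  by apply/negbTE; rewrite -leNgt; lra.
Unshelve. all: by end_near.
Qed.

Lemma agree_lt a c th :
  agree (fun x => H x * (x j < a)%R%:R * cos (dotv c x + th)).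
Proof. exact: Vlt. Qed.

End one_coordinate.

Lemma cramer_wold :
  (forall (c : rvec R I) (A : set (measurableTypeR R)), measurable A ->
    P [set h | A (dotv c h)] = Q [set h | A (dotv c h)]) ->
  forall A, measurable A -> P A = Q A.
Proof.
move=> PQ.
have agree_cos c th : agree (fun x => cos (dotv c x + th)).
  pose f (y : measurableTypeR R) := cos (y + th).
  have cf : continuous (f : R -> R).
    move=> y; apply: (@continuous_comp _ _ _ (fun y => y + th) cos).
      by apply: cvgD; [exact: cvg_id|exact: cvg_cst].
    exact: continuous_cos.
  have mf : measurable_fun setT f by exact: continuous_measurable_fun.
  have mfc : measurable_fun setT (fun x => cos (dotv c x + th)).
    by apply: (measurableT_comp mf); exact: measurable_dotv.
  have bf : exists M : R, forall x, `|cos (dotv c x + th)| <= M.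
    by exists 1 => x; rewrite ler_norml cos_geN1 cos_le1.
  split=> //.
  pose X : {mfun rvec R I >-> measurableTypeR R} := mfun_Sub (mem_set (measurable_dotv c)).
  have push (mu : probability (rvec R I) R) :
      (\int[distribution mu X]_y (f y)%:E =
      \int[mu]_x (cos (dotv c x + th))%:E)%E.
    rewrite integral_distribution//=.
    - exact/measurable_EFinP.
    - exact: bounded_integrable.
  rewrite -!push; by apply: eq_measure_integral => B mB _; exact: PQ.
(* Lists of constraints make boxes stable under intersection by concatenation, include the whole
   space as the empty list, and give the induction that adds one half-space at a time. *)
pose box (s : seq (I * R)) : set (rvec R I) := [set x | all (fun p => x p.1 < p.2) s].
have mbox s : measurable (box s).
  elim: s => [|[i a] s ih].
    by rewrite (_ : box [::] = setT)//; apply/seteqP; split.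
  rewrite (_ : box _ = [set x | x i < a] `&` box s); last first.
    by apply/seteqP; split=> x; rewrite /box/= => /andP.
  apply: measurableI => //.
  have := @measurable_rvec_coord R I i measurableT `]-oo, a[%classic (measurable_itv `]-oo, a[).
  rewrite setTI; congr measurable; apply/seteqP; split=> x;
    by rewrite /preimage/= in_itv.
have agree_box s c th : agree (fun x => \1_(box s) x * cos (dotv c x + th)).
  elim: s c th => [|[i a] s ih] c th.
    have := agree_cos c th; congr agree; apply/funext => x.
    by rewrite indicE mem_set// mul1r.
  have := agree_lt i ih a c th; congr agree; apply/funext => x.
  congr (_ * _); rewrite !indicE -natrM mulnb; congr (nat_of_bool _)%:R.
  by apply/idP/idP; rewrite !inE /box/= => /andP[]; rewrite ?inE => *; apply/andP; split;
    rewrite ?inE.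
apply: (@measure_unique _ _ _ (range box) (fun _ => box [::])).
- apply/seteqP; split.
  + apply: smallest_sub; first exact: smallest_sigma_algebra.
    move=> _ [i _ [A mA <-]]; rewrite setTI.
    have mA' := mA; rewrite RGenInftyO.measurableE in mA'.
    (* The sets whose preimage under coordinate i is generated by boxes form a sigma-algebra; it
       contains the half-lines ]-oo, a[, hence every Borel set. *)
    pose D : set (set R) := [set B | <<s range box >> ((fun h : rvec R I => h i) @^-1` B)].
    have : D A.
      apply: (mA' D); split; last first.
        move=> _ [a ->]; apply: sub_sigma_algebra; exists [:: (i, a)] => //.
        by apply/seteqP; split => x; rewrite /box/= /preimage/= in_itv/= andbT.
      split.
      - by rewrite /D/= preimage_set0; exact: sigma_algebra0.
      - move=> B DB; rewrite /D/= setTD preimage_setC.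
        exact: sigma_algebraC.
      - move=> F DF; rewrite /D/= preimage_bigcup.
        exact: sigma_algebra_bigcup.
    by [].
  + apply: smallest_sub; first exact: sigma_algebra_measurable.
    by move=> _ [s _ <-]; exact: mbox.
- move=> _ _ [s _ <-] [t _ <-]; exists (s ++ t) => //.
  by apply/seteqP; split => x; rewrite /box/= all_cat => /andP.
- by move=> _; exists [::].
- by apply/seteqP; split => // x _; exists 0%N.
- move=> _ [s _ <-]; case: (agree_box s 0 0) => _ _.
  have cE x : \1_(box s) x * cos (dotv 0 x + 0) = \1_(box s) x :> R.
    rewrite /dotv big1 => [|i _]; last by rewrite mul0r.
    by rewrite addr0 cos0 mulr1.
  under eq_integral do rewrite cE.
  under [RHS]eq_integral do rewrite cE.
  by rewrite !integral_indic// !setIT.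
- by move=> _; apply: (le_lt_trans (probability_le1 _ _)); rewrite ?ltry.
Qed.

End cramer_wold.

(** * Normal laws on the line *)

Definition pushforward_measure d1 d2 (T1 : measurableType d1)
  (T2 : measurableType d2) (R : realType) (m : {measure set T1 -> \bar R})
  (f : T1 -> T2) (mf : measurable_fun setT f) : {measure set T2 -> \bar R}.
Proof. by refine [the measure _ _ of pushforward m f]. Defined.

Section integral_density.
Local Open Scope ereal_scope.
Context d (T : measurableType d) (R : realType).
Variables (mu nu : {measure set T -> \bar R}) (g : T -> R).
Hypothesis mg : measurable_fun setT g.
Hypothesis g0 : forall x, (0 <= g x)%R.
Hypothesis nuE : forall A, measurable A -> nu A = \int[mu]_(x in A) (g x)%:E.

Import HBNNSimple.

(** For indicators this is the hypothesis [nuE]; linearity gives simple functions, and monotone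
    convergence on both sides gives the rest. *)
Lemma ge0_integral_density (f : T -> \bar R) :
  measurable_fun setT f -> (forall x, 0 <= f x) ->
  \int[nu]_x f x = \int[mu]_x (f x * (g x)%:E).
Proof.
move=> mf f0; pose f_ := nnsfun_approx measurableT mf.
transitivity (limn (fun n => \int[nu]_x (f_ n x)%:E)).
  rewrite -monotone_convergence//.
  - apply: eq_integral => y _; apply/esym/cvg_lim => //.
    by apply: cvg_nnsfun_approx.
  - by move=> n; exact/measurable_EFinP.
  - by move=> n y _; rewrite lee_fin.
  - by move=> y _ m n mn; rewrite lee_fin; exact/lefP/nd_nnsfun_approx.
rewrite [X in limn X](_ : _ = (fun n => \int[mu]_x ((f_ n x)%:E * (g x)%:E))).
  rewrite -monotone_convergence//; last 3 first.
  - move=> n; apply: emeasurable_funM; apply/measurable_EFinP => //.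
  - by move=> n x _; rewrite mule_ge0// lee_fin.
  - move=> x _ m n mn; rewrite lee_wpmul2r ?lee_fin//.
    exact/lefP/nd_nnsfun_approx.
  apply: eq_integral => x _; apply/cvg_lim => //.
  by apply: cvgeZr => //; exact: cvg_nnsfun_approx.
apply/funext => n.
have mfn r : measurable (f_ n @^-1` [set r]) by exact: measurable_sfunP.
under eq_integral do rewrite fimfunE -fsumEFin//.
rewrite ge0_integral_fsum//; last 2 first.
- by move=> y; exact/measurable_EFinP/measurable_funM.
- by move=> y x _; rewrite nnfun_muleindic_ge0.
transitivity (\sum_(r \in range (f_ n))
    \int[mu]_x ((r * \1_(f_ n @^-1` [set r]) x)%:E * (g x)%:E)).
  apply: eq_fsbigr => r _; rewrite integralZl_indic_nnsfun// integral_indic//= setIT.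
  have [r0|r0] := ltP r 0%R.
    rewrite preimage_nnfun0// measure0 mule0.
    by rewrite integral0_eq// => x _; rewrite indic0 mulr0 mul0e.
  under eq_integral do rewrite EFinM -muleA.
  rewrite ge0_integralZl//; last 2 first.
  - by apply: emeasurable_funM; exact/measurable_EFinP.
  - by move=> x _; rewrite mule_ge0// lee_fin.
  congr (_ * _); rewrite nuE// [LHS]integral_mkcond; apply: eq_integral => x _.
  by rewrite patchE indicE; case: ifPn; rewrite ?mul1e ?mul0e.
rewrite -ge0_integral_fsum//.
- apply: eq_integral => x _; rewrite [in RHS]fimfunE -fsumEFin//.
  rewrite ge0_mule_fsuml// => r; exact: nnfun_muleindic_ge0.
- move=> r; apply: emeasurable_funM; apply/measurable_EFinP => //.
  exact: measurable_funM.
- by move=> r x _; rewrite mule_ge0 ?lee_fin// -lee_fin EFinM nnfun_muleindic_ge0.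
Qed.

End integral_density.

Section normal_facts.
Variable R : realType.
Local Notation leb := (@lebesgue_measure R).
Local Notation mR := (measurableTypeR R).
Local Notation N1 := (normal_prob (0 : R) 1).

Lemma ge0_integral_normal_prob (m s : R) (f : R -> \bar R) :
  measurable_fun setT f -> (forall x, (0 <= f x)%E) ->
  (\int[normal_prob m s]_x f x = \int[leb]_x (f x * (normal_pdf m s x)%:E))%E.
Proof.
move=> mf f0; apply: ge0_integral_density => //.
  exact: measurable_normal_pdf.
exact: normal_pdf_ge0.
Qed.

Lemma measurable_affine (m s : R) : measurable_fun setT (fun z : mR => m + s * z : mR).
Proof. by apply: measurable_funD => //; exact: measurable_funM. Qed.

(** Lebesgue measure is determined by its values on half-open intervals. A negative [s] changes
    which endpoint the preimage contains, but not its length. *)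
Lemma lebesgue_measure_affine (m s : R) (A : set mR) : s != 0 -> measurable A ->
  (`|s|%:E * leb ((fun z : mR => (m + s * z)%R) @^-1` A) = leb A)%E.
Proof.
move=> s0 mA; pose f : mR -> mR := fun z => m + s * z.
have k0 : 0 <= `|s| by [].
pose mu' : {measure set mR -> \bar R} :=
  mscale (NngNum k0) (pushforward_measure leb (measurable_affine m s)).
suff -> : leb A = mu' A by [].
apply: lebesgue_measure_unique mA => _ [[a b] _ <-].
rewrite /mu'/= /mscale/= /pushforward_measure/= /pushforward.
have [sp|sn] := ltP 0 s.
- have -> : (fun z => m + s * z) @^-1` `]a, b] = `](a - m) / s, (b - m) / s]%classic.
    apply/seteqP; split => z; rewrite /preimage/= !in_itv/= ltr_pdivrMr// ler_pdivlMr//;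
      by move=> /andP[? ?]; apply/andP; split; lra.
  rewrite !lebesgue_measure_itv/= !lte_fin ltr_pM2r ?invr_gt0// ltrD2r.
  case: ifPn => ab; last by rewrite mule0.
  by rewrite -!EFinB -EFinM gtr0_norm//; congr EFin; field.
- have {}sn : s < 0 by rewrite lt_neqAle s0.
  have -> : (fun z => m + s * z) @^-1` `]a, b] = `[(b - m) / s, (a - m) / s[%classic.
    apply/seteqP; split => z; rewrite /preimage/= !in_itv/= ltr_ndivlMr// ler_ndivrMr//;
      by move=> /andP[? ?]; apply/andP; split; lra.
  rewrite !lebesgue_measure_itv/= !lte_fin ltr_nM2r ?invr_lt0// ltrD2r.
  case: ifPn => ab; last by rewrite mule0.
  by rewrite -!EFinB -EFinM ltr0_norm//; congr EFin; field.
Qed.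

Lemma ge0_integral_affine (m s : R) (f : mR -> \bar R) : s != 0 ->
  measurable_fun setT f -> (forall x, (0 <= f x)%E) ->
  (`|s|%:E * \int[leb]_z f (m + s * z)%R = \int[leb]_x f x)%E.
Proof.
move=> s0 mf f0.
have k0 : 0 <= `|s| by [].
pose h : mR -> mR := fun z => m + s * z.
have mh : measurable_fun setT h := measurable_affine m s.
pose mu' := pushforward_measure leb mh.
transitivity (\int[mscale (NngNum k0) mu']_x f x)%E.
  by rewrite ge0_integral_mscale//= (ge0_integral_pushforward mh).
apply: eq_measure_integral => /= A mA _.
by rewrite -(lebesgue_measure_affine m s0 mA).
Qed.

Lemma normal_peak_norm (s : R) : normal_peak s = (`|s| * Num.sqrt (pi *+ 2))^-1.
Proof. by rewrite /normal_peak -mulrnAr sqrtrM ?sqr_ge0// sqrtr_sqr. Qed.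

(** Puts Dirac masses and normal laws in one form, for either sign of [s], so that laws are compared
    as images of [N1]. *)
Lemma gaussian_lawE (m s : R) (A : set mR) : measurable A ->
  gaussian_law m s A = N1 ((fun z => m + s * z) @^-1` A).
Proof.
move=> mA; rewrite /gaussian_law; have [->|s0] := eqVneq s 0.
  rewrite diracE.
  have [mA'|mA'] := boolP (m \in A).
    rewrite (_ : _ @^-1` _ = setT) ?probability_setT//.
    by apply/seteqP; split=> // z _; rewrite /preimage/= mul0r addr0; exact: set_mem.
  rewrite (_ : _ @^-1` _ = set0) ?measure0//.
  apply/seteqP; split=> // z; rewrite /preimage/= mul0r addr0 => /mem_set.
  by rewrite (negbTE mA').
have mA' : measurable ((fun z : mR => m + s * z : mR) @^-1` A).
  by rewrite -[X in measurable X]setTI; exact: measurable_affine.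
rewrite /normal_prob integral_mkcond.
rewrite -(ge0_integral_affine m s0); last 2 first.
- apply/(measurable_restrictT _ mA)/measurable_EFinP/measurable_funTS.
  exact: measurable_normal_pdf.
- by move=> x; rewrite patchE; case: ifP => //; rewrite lee_fin normal_pdf_ge0.
rewrite -ge0_integralZl//; last 2 first.
- apply: (measurableT_comp _ (measurable_affine m s)).
  apply/(measurable_restrictT _ mA)/measurable_EFinP/measurable_funTS.
  exact: measurable_normal_pdf.
- by move=> x _; rewrite patchE; case: ifP => //; rewrite lee_fin normal_pdf_ge0.
rewrite [RHS]integral_mkcond; apply: eq_integral => z _.
rewrite !patchE; have -> : (z \in (fun z => m + s * z) @^-1` A) = (m + s * z \in A).
  by apply/idP/idP; rewrite !inE.
case: ifP => _; last by rewrite mule0.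
rewrite -EFinM !normal_pdfE ?oner_neq0// !normal_peak_norm /normal_fun; congr EFin.
rewrite normr1 mul1r invfM !mulrA mulfV ?normr_eq0// mul1r; congr (_ * expR _).
by field.
Qed.

Lemma normal_prob0N (s : R) (A : set mR) : normal_prob 0 (- s) A = normal_prob 0 s A.
Proof.
rewrite /normal_prob; apply: eq_integral => x _.
by rewrite /normal_pdf /normal_peak /normal_fun oppr_eq0 sqrrN.
Qed.

Lemma gaussian_law_norm (s : R) (A : set mR) : gaussian_law 0 s A = gaussian_law 0 `|s| A.
Proof.
rewrite /gaussian_law normr_eq0; case: ifP => _; first by [].
have [s0|s0] := leP 0 s; first by rewrite (ger0_norm s0).
by rewrite (ltr0_norm s0) normal_prob0N.
Qed.

(* Completing the square in [x]. *)
Lemma normal_pdf_mul (c t x y : R) : t != 0 ->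
  normal_pdf 0 1 x * normal_pdf (c * x) t y =
  normal_pdf 0 (Num.sqrt (c ^+ 2 + t ^+ 2)) y *
  normal_pdf (c / (c ^+ 2 + t ^+ 2) * y) (t / Num.sqrt (c ^+ 2 + t ^+ 2)) x.
Proof.
move=> t0; set k2 := c ^+ 2 + t ^+ 2; pose k := Num.sqrt k2.
have k20 : 0 < k2 by rewrite ltr_wpDl ?sqr_ge0// exprn_even_gt0.
have k0 : 0 < k by rewrite sqrtr_gt0.
have kE : k ^+ 2 = k2 by rewrite sqr_sqrtr// ltW.
have k0' : k != 0 by rewrite gt_eqF.
have tk0 : t / k != 0 by rewrite mulf_neq0 ?invr_neq0.
rewrite -/k (normal_pdfE _ (oner_neq0 R)) (normal_pdfE _ t0) (normal_pdfE _ k0').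
rewrite (normal_pdfE _ tk0).
rewrite !normal_peak_norm /normal_fun !mulrA normr1 normrM normfV (gtr0_norm k0) mul1r.
have pi0 : Num.sqrt (pi *+ 2) != 0 :> R.
  by rewrite gt_eqF// sqrtr_gt0 mulrn_wgt0// pi_gt0.
have nt0 : `|t| != 0 by rewrite normr_eq0.
have mulE (a e b f : R) : a * expR e / b * expR f = a / b * expR (e + f).
  by rewrite expRD; ring.
rewrite !mulE; congr (_ * expR _).
  by field; rewrite nt0 pi0 k0'.
rewrite expr_div_n expr1n kE.
have : c ^+ 2 + t ^+ 2 != 0 by rewrite gt_eqF.
by move=> h; rewrite /k2; field; rewrite h t0.
Qed.

Lemma measurable_normal_pdf_mean (c t : R) : t != 0 ->
  measurable_fun setT (fun z : mR * mR => normal_pdf (c * z.1) t z.2).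
Proof.
move=> t0; rewrite (_ : (fun _ => _) = fun z : mR * mR => normal_pdf 0 t (z.2 - c * z.1)).
  apply: (measurableT_comp (measurable_normal_pdf 0 t)).
  by apply: measurable_funB => //; apply: measurable_funM.
by apply/funext => z; rewrite !normal_pdfE// /normal_fun subr0.
Qed.

(** This is the law of c X + t Z for independent standard normal X and Z. After the integrals are
    exchanged, completing the square leaves a normal density in x, of total mass 1. *)
Lemma normal_convolution (c t : R) (A : set mR) : measurable A ->
  (\int[N1]_x N1 [set z | A (c * x + t * z)%R] =
   N1 [set z | A (Num.sqrt (c ^+ 2 + t ^+ 2) * z)%R])%E.
Proof.
move=> mA; have mpre (m s : R) : measurable [set z : mR | A (m + s * z)].
  by rewrite -[X in measurable X]setTI; exact: measurable_affine.
have shift (s : R) : [set z | A (s * z)] = (fun z => 0 + s * z) @^-1` A.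
  by apply/seteqP; split=> z; rewrite /preimage/= add0r.
(* For [t = 0] the inner law is a Dirac mass, so the left side is the law of c X; its scale |c| is
   exchanged for c by symmetry. *)
have [->|t0] := eqVneq t 0.
  rewrite expr0n/= addr0 sqrtr_sqr shift -gaussian_lawE// -gaussian_law_norm.
  rewrite gaussian_lawE// -shift -[X in _ = normal_prob _ _ X]setIT -integral_indic//; last first.
    by rewrite shift; exact: mpre.
  apply: eq_integral => x _; rewrite indicE.
  have [/set_mem xA|xA] := boolP (x \in [set z | A (c * z)]).
    rewrite (_ : [set z | _] = setT) ?probability_setT//.
    by apply/seteqP; split=> // z _ /=; rewrite mul0r addr0.
  rewrite (_ : [set z | _] = set0) ?measure0//.
  apply/seteqP; split=> // z/=; rewrite mul0r addr0 => Ax.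
  by move: xA; rewrite notin_setE.
set k := Num.sqrt _.
have k2 : 0 < c ^+ 2 + t ^+ 2 by rewrite ltr_wpDl ?sqr_ge0// exprn_even_gt0.
have k0 : k != 0 by rewrite gt_eqF// sqrtr_gt0.
have inner x : N1 [set z | A (c * x + t * z)] = normal_prob (c * x) t A.
  have := gaussian_lawE (c * x) t mA; rewrite /gaussian_law (negbTE t0) => ->.
  by [].
under eq_integral do rewrite inner.
have := gaussian_lawE 0 k mA; rewrite /gaussian_law (negbTE k0) -shift => <-.
pose F (z : mR * mR) : \bar R :=
  (normal_pdf 0 1 z.1 * (normal_pdf (c * z.1) t z.2 * \1_A z.2))%:E.
have mF : measurable_fun setT F.
  apply/measurable_EFinP; apply: measurable_funM.
    exact: (measurableT_comp (measurable_normal_pdf 0 1)).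
  apply: measurable_funM; first exact: measurable_normal_pdf_mean.
  by apply: (measurableT_comp _ measurable_snd); exact: measurable_indic.
have F0 z : (0 <= F z)%E.
  by rewrite lee_fin !mulr_ge0 ?normal_pdf_ge0.
have mprob : measurable_fun setT (fun x : mR => normal_prob (c * x) t A).
  pose G (z : mR * mR) : \bar R := (normal_pdf (c * z.1) t z.2 * \1_A z.2)%:E.
  rewrite (_ : (fun _ => _) = fubini_F leb G).
    apply: measurable_fun_fubini_tonelli_F.
    - apply/measurable_EFinP/measurable_funM; first exact: measurable_normal_pdf_mean.
      by apply: (measurableT_comp _ measurable_snd); exact: measurable_indic.
    - by move=> z; rewrite lee_fin mulr_ge0 ?normal_pdf_ge0.
  apply/funext => x; rewrite /normal_prob integral_mkcond; apply: eq_integral => y _.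
  by rewrite /G patchE indicE; case: ifP => _; rewrite ?mulr1 ?mulr0.
rewrite ge0_integral_normal_prob//.
transitivity (\int[leb]_x \int[leb]_y F (x, y))%E.
  apply: eq_integral => x _; rewrite /F/= /normal_prob integral_mkcond muleC.
  rewrite -ge0_integralZl//=; last 3 first.
  - apply/(measurable_restrictT _ mA)/measurable_EFinP/measurable_funTS.
    exact: measurable_normal_pdf.
  - by move=> y _; rewrite patchE; case: ifP => //; rewrite lee_fin normal_pdf_ge0.
  - by rewrite lee_fin normal_pdf_ge0.
  apply: eq_integral => y _; rewrite patchE indicE.
  by case: ifP => _; rewrite ?mulr1 ?mulr0 ?mule0// EFinM.
rewrite fubini_tonelli// /normal_prob [RHS]integral_mkcond.
apply: eq_integral => y _; rewrite patchE.
case: ifPn => yA; last first.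
  by rewrite integral0_eq// => x _; rewrite /F/= indicE (negbTE yA) !mulr0.
transitivity (\int[leb]_x ((normal_pdf 0 k y)%:E *
    (normal_pdf (c / (c ^+ 2 + t ^+ 2) * y) (t / k) x)%:E))%E.
  apply: eq_integral => x _; rewrite /F/= indicE yA mulr1 normal_pdf_mul//.
rewrite ge0_integralZl//.
- by rewrite integral_normal_pdf mule1.
- by apply/measurable_EFinP; exact: (@measurable_normal_pdf _ _ (t / k)).
- by move=> x _; rewrite lee_fin normal_pdf_ge0.
- by rewrite lee_fin normal_pdf_ge0.
Qed.

End normal_facts.

(** * Moments of the standard normal law *)

Section normal_moments.
Variable R : realType.
Local Notation leb := (@lebesgue_measure R).
Local Notation mR := (measurableTypeR R).
Local Notation N1 := (normal_prob (0 : R) 1).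
Let p : R -> R := normal_pdf 0 1.

Let pE x : p x = normal_peak 1 * expR (- (x ^+ 2 / 2)).
Proof.
by rewrite /p normal_pdfE ?oner_neq0// /normal_fun subr0 expr1n mulNr.
Qed.

Let p_even x : p (- x) = p x. Proof. by rewrite !pE sqrrN. Qed.

Let dp (x : R) : is_derive x 1 (fun y => - p y) (x * p x).
Proof.
rewrite (_ : (fun y => - p y) = fun y => - (normal_peak 1 * expR (- (y ^+ 2 / 2)))).
  rewrite pE.
  have d2 : is_derive x 1 (fun y : R => - (y ^+ 2 / 2)) (- x).
    by apply: is_derive_eq; rewrite /= !scaler0 /GRing.scale/=; field.
  have de : is_derive x 1 (fun y : R => expR (- (y ^+ 2 / 2)))
      (- x * expR (- (x ^+ 2 / 2))).
    have := @is_derive1_comp _ expR (fun y : R => - (y ^+ 2 / 2)) x _ _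
      (is_derive_expR _) d2.
    by rewrite mulrC.
  by apply: is_derive_eq; rewrite /= /GRing.scale/=; ring.
by apply/funext => y; rewrite pE.
Qed.

Let p_cvg : - p x @[x --> +oo%R] --> (0 : R).
Proof.
rewrite -[X in _ --> X]oppr0; apply: cvgN.
rewrite (_ : p = fun x => normal_peak 1 * expR (- (x ^+ 2 / 2))); last first.
  by apply/funext => x; rewrite pE.
rewrite -[X in _ --> X](mulr0 (normal_peak 1)); apply: cvgMr.
apply: (cvg_comp (fun x : R => x ^+ 2 / 2) (fun x => expR (- x))).
  by apply: gt0_cvgMly => //; exact: cvgr_expr2.
exact: cvgr_expR.
Qed.

Let mp : measurable_fun setT p. Proof. exact: measurable_normal_pdf. Qed.

Let cp : continuous p.
Proof. by apply: continuous_normal_pdf; exact: oner_neq0. Qed.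

Let p0 x : 0 <= p x. Proof. exact: normal_pdf_ge0. Qed.

Let half (f : R -> R) : (forall x, 0 <= f x) -> continuous f ->
  (forall x, f (- x) = f x) ->
  (\int[leb]_x (f x)%:E = 2 * \int[leb]_(x in `[0%R, +oo[) (f x)%:E)%E.
Proof.
move=> f0 cf fN; rewrite ge0_symfun_integralT//; last by move=> x /=; rewrite fN.
rewrite (_ : [set x | _] = `[0%R, +oo[%classic)//.
by apply/seteqP; split=> x/=; rewrite in_itv/= andbT.
Qed.

Let tail (x : R) : 0 <= x -> (\int[leb]_(y in `[x, +oo[) (y * p y)%:E = (p x)%:E)%E.
Proof.
move=> x0; rewrite (@ge0_continuous_FTC2y _ (fun y => y * p y) (fun y => - p y) x 0).
- by rewrite -EFinB sub0r opprK.
- by move=> y xy; rewrite mulr_ge0// (le_trans x0).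
- apply: continuous_subspaceT => y; apply: cvgM; first exact: cvg_id.
  exact: cp.
- exact: p_cvg.
- by move=> y _; apply: ex_derive; exact: dp.
- apply: cvgN; apply: cvg_at_right_filter; exact: cp.
- by move=> y _; rewrite derive1E; apply: derive_val; exact: dp.
Qed.

(** Tonelli takes the place of integration by parts: one factor y is written as the length of
    [0, y], and integrating y p(y) over y >= x first gives p(x) by [tail]. *)
Let second_half :
  (\int[leb]_(y in `[0%R, +oo[) (y ^+ 2 * p y)%:E = \int[leb]_(x in `[0%R, +oo[) (p x)%:E)%E.
Proof.
pose S : set (mR * mR) := [set z | 0 <= z.1 /\ z.1 <= z.2].
have mS : measurable S.
  rewrite (_ : S = (fun z => 0 <= z.1) @^-1` [set true] `&`
                   (fun z => z.1 <= z.2) @^-1` [set true]).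
    apply: measurableI; rewrite -[X in measurable X]setTI.
    - by apply: (measurable_fun_ler (measurable_cst _) measurable_fst).
    - by apply: (measurable_fun_ler measurable_fst measurable_snd).
  by apply/seteqP; split.
pose F (z : mR * mR) : \bar R := (\1_S z * (z.2 * p z.2))%:E.
have F0 z : (0 <= F z)%E.
  rewrite lee_fin indicE; have [/set_mem[z1 z2]|] := boolP (z \in S).
    by rewrite mul1r mulr_ge0// (le_trans z1).
  by rewrite mul0r.
have mF : measurable_fun setT F.
  apply/measurable_EFinP; apply: measurable_funM; first exact: measurable_indic.
  by apply: measurable_funM => //; exact: (measurableT_comp mp).
transitivity (\int[leb]_y \int[leb]_x F (x, y))%E.
  rewrite integral_mkcond; apply: eq_integral => y _; rewrite patchE mem_setE.
  rewrite in_itv/= andbT; have [y0|y0] := leP 0 y; last first.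
    rewrite integral0_eq// => x _; rewrite /F indicE memNset ?mul0r//= => -[x0 xy].
    by move: y0; rewrite ltNge (le_trans x0).
  transitivity (\int[leb]_(x in `[0%R, y]) (y * p y)%:E)%E.
    rewrite integral_cst//= lebesgue_measure_itv/= lte_fin.
    case: ifPn => [y0'|]; first by rewrite -EFinB subr0 -EFinM; congr EFin; ring.
    rewrite -leNgt mule0 => y0'; have -> : y = 0 by apply/eqP; rewrite eq_le y0'.
    by rewrite expr0n/= mul0r.
  rewrite integral_mkcond; apply: eq_integral => x _; rewrite patchE /F indicE /=.
  rewrite (_ : ((x, y) \in S) = (x \in `[0%R, y]%classic)).
    by case: ifP; rewrite ?mul1r ?mul0r.
  by apply/idP/idP; rewrite !inE/= in_itv/= => /andP.
rewrite -fubini_tonelli// [RHS]integral_mkcond; apply: eq_integral => x _.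
rewrite patchE mem_setE in_itv/= andbT; have [x0|x0] := leP 0 x; last first.
  rewrite integral0_eq// => y _; rewrite /F indicE memNset ?mul0r//= => -[+ _].
  by rewrite leNgt x0.
rewrite -tail// [RHS]integral_mkcond; apply: eq_integral => y _.
rewrite patchE /F indicE/= (_ : ((x, y) \in S) = (y \in `[x, +oo[%classic)).
  by case: ifP; rewrite ?mul1r ?mul0r.
by apply/idP/idP; rewrite !inE/= in_itv/= andbT => // -[].
Qed.

Lemma normal_second_moment : (\int[N1]_x (x ^+ 2)%:E = 1)%E.
Proof.
rewrite ge0_integral_normal_prob; last 2 first.
- by apply/measurable_EFinP; exact: measurable_funX.
- by move=> x; rewrite lee_fin sqr_ge0.
under eq_integral do rewrite -EFinM.
rewrite half; last 3 first.
- by move=> x; rewrite mulr_ge0// sqr_ge0.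
- by move=> x; apply: cvgM; [exact: exprn_continuous|exact: cp].
- by move=> x; rewrite -/(p (- x)) p_even sqrrN.
by rewrite second_half -half// integral_normal_pdf.
Qed.

Lemma integrable_normal_sqr : N1.-integrable setT (fun x => (x ^+ 2)%:E).
Proof.
apply/integrableP; split; first by apply/measurable_EFinP; exact: measurable_funX.
under eq_integral do rewrite /= ger0_norm ?sqr_ge0//.
by rewrite normal_second_moment ltry.
Qed.

Lemma integrable_normal_id : N1.-integrable setT (fun x : R => x%:E).
Proof.
apply: (@le_integrable _ mR R N1 setT measurableT (fun x => x%:E) (fun x => (1 + x ^+ 2)%:E)).
- exact/measurable_EFinP.
- move=> x _; rewrite lee_fin [leRHS]ger0_norm ?addr_ge0 ?sqr_ge0//.
  by rewrite -(real_normK (num_real x)); nra.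
- under [X in integrable _ _ X]eq_fun do rewrite EFinD.
  apply: integrableD => //; last exact: integrable_normal_sqr.
  exact: finite_measure_integrable_cst.
Qed.

(** Reflection preserves the law, so the integral equals its opposite; integrability makes it
    finite, hence 0. *)
Lemma normal_first_moment : (\int[N1]_x x%:E = 0)%E.
Proof.
have m1 : measurable_fun setT (fun z : mR => - z : mR) by exact: measurable_funN.
have e : (\int[N1]_x x%:E = - \int[N1]_x x%:E)%E.
  rewrite -integralN; last first.
    by apply: integrable_add_def => //; exact: integrable_normal_id.
  rewrite -[RHS](@integral_pushforward _ _ _ _ _ _ m1 N1 setT (fun x => x%:E))//; last 2 first.
  - exact/measurable_EFinP.
  - by rewrite preimage_setT; exact: (integrableN integrable_normal_id).
  apply: (eq_measure_integral (pushforward_measure N1 m1)) => A mA _.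
  have := gaussian_lawE 0 (-1) mA; rewrite /gaussian_law oppr_eq0 oner_eq0.
  rewrite normal_prob0N => e; apply: (etrans e); congr (normal_prob _ _ _).
  by apply/seteqP; split=> z; rewrite /preimage/= add0r mulN1r.
have := integrable_fin_num measurableT integrable_normal_id.
move: e; case: (\int[N1]_x x%:E)%E => //= r [re] _; congr EFin; lra.
Qed.

End normal_moments.

(** * Products of normal laws *)

Section tuple_measure.
Variable R : realType.
Local Notation leb := (@lebesgue_measure R).
Local Notation mR := (measurableTypeR R).
Local Notation sfm T := {sigma_finite_measure set T -> \bar R}.

Definition tcons d (p : mR * d.-tuple mR) : d.+1.-tuple mR := [tuple of p.1 :: p.2].

Lemma measurable_tcons d : measurable_fun setT (@tcons d).
Proof. exact: (measurable_cons measurable_fst measurable_snd). Qed.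

Section tcons_measure.
Variables (d : nat) (m1 : sfm mR) (m2 : sfm (d.-tuple mR)).

Definition tcons_measure : set (d.+1.-tuple mR) -> \bar R :=
  pushforward (m1 \x m2)%E (@tcons d).

HB.instance Definition _ := Measure.copy tcons_measure
  (pushforward_measure (m1 \x m2)%E (@measurable_tcons d)).

Let sigma_finite_tcons : sigma_finite setT tcons_measure.
Proof.
have /sigma_finiteP[F [TF ndF Foo]] := sigma_finiteT m1.
have /sigma_finiteP[G [TG ndG Goo]] := sigma_finiteT m2.
pose u (t : d.+1.-tuple mR) : mR * d.-tuple mR := (thead t, [tuple of behead t]).
have mu : measurable_fun setT u.
  by apply: measurable_fun_pair; [exact: measurable_tnth|exact: measurable_behead].
have uK : cancel (@tcons d) u by move=> [x t]; congr pair; apply/val_inj.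
exists (fun n => u @^-1` (F n `*` G n)).
  apply/seteqP; split=> // t _.
  have : [set: mR] (u t).1 by [].
  have : [set: d.-tuple mR] (u t).2 by [].
  rewrite TF TG => -[k _ Gk] [n _ Fn]; exists (maxn n k) => //; split.
    by move: Fn; apply/subsetPset/ndF/leq_maxl.
  by move: Gk; apply/subsetPset/ndG/leq_maxr.
move=> n; have [mF Ffin] := Foo n; have [mG Gfin] := Goo n; split.
  by rewrite -[X in measurable X]setTI; apply: mu => //; exact: measurableX.
rewrite /tcons_measure /pushforward (_ : _ @^-1` _ = F n `*` G n); last first.
  by rewrite -comp_preimage (_ : u \o _ = id) ?preimage_id//; apply/funext => z; exact: uK.
by rewrite product_measure1E// lte_mul_pinfty// ge0_fin_numE.
Qed.

HB.instance Definition _ :=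
  Measure_isSigmaFinite.Build _ _ _ tcons_measure sigma_finite_tcons.

End tcons_measure.

(** The factors are only sigma-finite, so that one construction, with one Tonelli rule, yields both
    [lebesgue_tuple] and the products of normal laws. *)
Fixpoint tuple_measure d : ('I_d -> sfm mR) -> sfm (d.-tuple mR) :=
  match d with
  | 0 => fun=> (dirac [tuple] : sfm (0.-tuple mR))
  | d'.+1 => fun m => tcons_measure (m ord0)
                        (tuple_measure (fun i : 'I_d' => m (lift ord0 i)))
                      : sfm (d'.+1.-tuple mR)
  end.

Lemma ge0_integral_tuple0 (m : 'I_0 -> sfm mR) (f : 0.-tuple mR -> \bar R) :
  measurable_fun setT f ->
  (\int[tuple_measure m]_t f t = f [tuple])%E.
Proof. by move=> mf; rewrite integral_dirac// diracT mul1e. Qed.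

Lemma ge0_integral_tupleS d (m : 'I_d.+1 -> sfm mR) (f : d.+1.-tuple mR -> \bar R) :
  measurable_fun setT f -> (forall t, (0 <= f t)%E) ->
  (\int[tuple_measure m]_t f t =
   \int[m ord0]_x \int[tuple_measure (fun i => m (lift ord0 i))]_t f (tcons (x, t)))%E.
Proof.
move=> mf f0.
rewrite (ge0_integral_pushforward (@measurable_tcons d))//= fubini_tonelli1//.
exact: (measurableT_comp mf (@measurable_tcons d)).
Qed.

Lemma lebesgue_tupleE d : lebesgue_tuple R d = tuple_measure (fun _ : 'I_d => leb).
Proof. by elim: d => //= d ->. Qed.

Lemma tcons0 d x (t : d.-tuple mR) : tnth (tcons (x, t)) ord0 = x.
Proof. by []. Qed.

Lemma tconsS d x (t : d.-tuple mR) i : tnth (tcons (x, t)) (lift ord0 i) = tnth t i.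
Proof. exact: tnthS. Qed.

Lemma measurable_tcons_l d x : measurable_fun setT (fun t : d.-tuple mR => tcons (x, t)).
Proof. exact: (measurable_cons (measurable_cst x) (@measurable_id _ _ setT)). Qed.

Section gaussian_tuple.

Definition gaussian_tuple d (s : 'I_d -> R) : sfm (d.-tuple mR) :=
  tuple_measure (fun i => [the sfm mR of normal_prob 0 (s i)]).

Lemma measurable_prod_pdf d (s : 'I_d -> R) :
  measurable_fun setT (fun t : d.-tuple mR => \prod_i normal_pdf 0 (s i) (tnth t i)).
Proof.
apply: measurable_prod => i _.
exact: (measurableT_comp (measurable_normal_pdf 0 (s i)) (measurable_tnth i)).
Qed.

Lemma ge0_integral_gaussian_tupleS d (s : 'I_d.+1 -> R) (f : d.+1.-tuple mR -> \bar R) :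
  measurable_fun setT f -> (forall t, (0 <= f t)%E) ->
  (\int[gaussian_tuple s]_t f t = \int[normal_prob 0 (s ord0)]_x
     \int[gaussian_tuple (fun i => s (lift ord0 i))]_t f (tcons (x, t)))%E.
Proof. exact: ge0_integral_tupleS. Qed.

Lemma gaussian_tuple_density d (s : 'I_d -> R) (f : d.-tuple mR -> \bar R) :
  measurable_fun setT f -> (forall t, (0 <= f t)%E) ->
  (\int[gaussian_tuple s]_t f t = \int[lebesgue_tuple R d]_t
     (f t * (\prod_i normal_pdf 0 (s i) (tnth t i))%:E))%E.
Proof.
rewrite lebesgue_tupleE.
have prod0 k (r : 'I_k -> R) (t : k.-tuple mR) :
    (0 <= (\prod_i normal_pdf 0 (r i) (tnth t i))%:E)%E.
  by rewrite lee_fin prodr_ge0// => i _; exact: normal_pdf_ge0.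
elim: d s f => [|d ih] s f mf f0.
  rewrite !ge0_integral_tuple0//; first by rewrite big_ord0 mule1.
  by apply: emeasurable_funM => //; apply/measurable_EFinP; exact: measurable_prod_pdf.
rewrite ge0_integral_gaussian_tupleS// [RHS]ge0_integral_tupleS; last 2 first.
- by apply: emeasurable_funM => //; apply/measurable_EFinP; exact: measurable_prod_pdf.
- by move=> t; rewrite mule_ge0.
rewrite ge0_integral_normal_prob; last 2 first.
- apply: (@measurable_fun_fubini_tonelli_F _ _ mR _ R (gaussian_tuple (fun i : 'I_d => s (lift ord0 i))) (fun z => f (tcons z))) => //.
  exact: (measurableT_comp mf (@measurable_tcons d)).
- by move=> x; apply: integral_ge0.
apply: eq_integral => x _.
have mfx : measurable_fun setT (fun t : d.-tuple mR => f (tcons (x, t))).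
  exact: (measurableT_comp mf (measurable_tcons_l x)).
rewrite ih// muleC -ge0_integralZl//=; last 3 first.
- by apply: emeasurable_funM => //; apply/measurable_EFinP; exact: measurable_prod_pdf.
- by move=> t _; apply: mule_ge0 => //; exact: (prod0 _ (fun i => s (lift ord0 i))).
- by rewrite lee_fin normal_pdf_ge0.
apply: eq_integral => t _; rewrite big_ord_recl tcons0 muleCA -EFinM.
by under [in RHS]eq_bigr do rewrite tconsS.
Qed.

Lemma measurable_lincomb d (c : 'I_d -> R) :
  measurable_fun setT (fun t : d.-tuple mR => \sum_i c i * tnth t i : mR).
Proof.
apply: measurable_sum => i; apply: measurable_funM => //; exact: measurable_tnth.
Qed.

Lemma gaussian_tuple_lincomb d (s c : 'I_d -> R) (A : set mR) :
  (forall i, s i != 0) -> measurable A ->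
  gaussian_tuple s [set t | A (\sum_i c i * tnth t i)] =
  normal_prob 0 1 [set z | A (Num.sqrt (\sum_i (c i * s i) ^+ 2) * z)].
Proof.
elim: d s c A => [|d ih] s c A s0 mA.
  have -> : [set z | A (Num.sqrt (\sum_(i < 0) (c i * s i) ^+ 2) * z)] =
            [set z : R | A 0].
    by apply/seteqP; split=> z/=; rewrite big_ord0 sqrtr0 mul0r.
  rewrite /gaussian_tuple/= /dirac indicE.
  have [A0|A0] := pselect (A 0).
    rewrite mem_set/=; last by rewrite big_ord0.
    by rewrite (_ : [set _ | _] = setT) ?probability_setT//; apply/seteqP; split.
  rewrite memNset/=; last by rewrite big_ord0.
  by rewrite (_ : [set _ | _] = set0) ?measure0//; apply/seteqP; split.
pose T := [set t : d.+1.-tuple mR | A (\sum_i c i * tnth t i)].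
have mT : measurable T.
  by rewrite -[X in measurable X]setTI; exact: measurable_lincomb.
rewrite -/T -[T]setIT -integral_indic// ge0_integral_gaussian_tupleS; last 2 first.
- by apply/measurable_EFinP; exact: measurable_indic.
- by move=> t; rewrite lee_fin.
pose c' i := c (lift ord0 i); pose s' i := s (lift ord0 i).
pose k := Num.sqrt (\sum_i (c' i * s' i) ^+ 2).
have inner x : (\int[gaussian_tuple s']_t (\1_T (tcons (x, t)))%:E =
    normal_prob 0 1 [set z | A (c ord0 * x + k * z)%R])%E.
  (* With the first coordinate fixed at x, the remaining sum has to fall into a translate of [A], to
     which the induction hypothesis applies. *)
  pose B : set mR := [set y | A (c ord0 * x + 1 * y)].
  have mB : measurable B.
    by rewrite -[X in measurable X]setTI; exact: measurable_affine.
  transitivity (gaussian_tuple s' [set t | B (\sum_i c' i * tnth t i)]).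
    rewrite -[[set t | _]]setIT -integral_indic//; last first.
      by rewrite -[X in measurable X]setTI; exact: measurable_lincomb.
    apply: eq_integral => t _; rewrite !indicE; congr (nat_of_bool _)%:R%:E.
    have tE : \sum_i c i * tnth (tcons (x, t)) i =
        c ord0 * x + \sum_i c' i * tnth t i.
      by rewrite big_ord_recl tcons0; under eq_bigr do rewrite tconsS.
    by apply/idP/idP; rewrite !inE /T/= /B/= tE mul1r.
  rewrite ih//; first by congr normal_prob; apply/seteqP; split=> z; rewrite /B/= mul1r.
  by move=> i; exact: s0.
under eq_integral do rewrite inner.
have m0 : measurable_fun setT (fun z : mR => 0 + s ord0 * z : mR).
  exact: measurable_affine.
have mF : measurable_fun setT
    (fun x : mR => normal_prob 0 1 [set z | A (c ord0 * x + k * z)] : \bar R).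
  rewrite (_ : (fun _ => _) = normal_prob 0 1 \o xsection
      [set z : mR * mR | A (c ord0 * z.1 + k * z.2)]).
    apply: measurable_fun_xsection; rewrite -[X in measurable X]setTI.
    suff : measurable_fun setT (fun z : mR * mR => c ord0 * z.1 + k * z.2 : mR) by exact.
    by apply: measurable_funD; apply: measurable_funM.
  by apply/funext => x/=; congr normal_prob; apply/seteqP; split=> z;
    rewrite /xsection/= inE.
(* The first coordinate, of scale [s ord0], is rewritten as a multiple of a standard normal one, as
   [normal_convolution] expects. *)
transitivity (\int[normal_prob 0 1]_x normal_prob 0 1
    [set z | A (c ord0 * s ord0 * x + k * z)%R])%E.
  transitivity (\int[pushforward_measure (normal_prob 0 1) m0]_x
      normal_prob 0 1 [set z | A (c ord0 * x + k * z)%R])%E.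
    apply: eq_measure_integral => B mB _.
    by have := gaussian_lawE 0 (s ord0) mB; rewrite /gaussian_law (negbTE (s0 _)).
  rewrite (ge0_integral_pushforward m0)//=.
  apply: eq_integral => x _; congr normal_prob; apply/seteqP.
  by split=> z/=; rewrite add0r mulrA.
rewrite normal_convolution// /k sqr_sqrtr; last first.
  by apply: sumr_ge0 => i _; exact: sqr_ge0.
by rewrite [in RHS]big_ord_recl.
Qed.

Lemma gaussian_tuple_setT d (s : 'I_d -> R) :
  (forall i, s i != 0) -> gaussian_tuple s setT = 1%E.
Proof.
move=> s0; have := gaussian_tuple_lincomb (fun=> 0) s0 (@measurableT _ mR).
rewrite (_ : [set _ | _] = setT)// (_ : [set z | _] = setT) ?probability_setT//.
Qed.

End gaussian_tuple.
End tuple_measure.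

(** * Gaussian combinations of vectors *)

Section gaussian_combination.
Variables (R : realType) (I : finType) (d : nat).
Local Notation mR := (measurableTypeR R).
Implicit Types (e : 'I_d -> rvec R I) (s : 'I_d -> R).

Definition comb e (t : d.-tuple mR) : rvec R I := \sum_i (tnth t i : R) *: e i.

Lemma combE e t v : comb e t v = \sum_i tnth t i * e i v.
Proof. by rewrite /comb fct_sumE. Qed.

Lemma measurable_comb e : measurable_fun setT (comb e).
Proof.
apply: measurable_rvec => v.
rewrite (_ : (fun t => _) = fun t : d.-tuple mR => \sum_i e i v * tnth t i).
  exact: measurable_lincomb.
by apply/funext => t; rewrite combE; apply: eq_bigr => i _; rewrite mulrC.
Qed.

Lemma dotv_comb e c t : dotv c (comb e t) = \sum_i dotv c (e i) * tnth t i.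
Proof.
rewrite /dotv; under eq_bigr do rewrite combE mulr_sumr.
rewrite exchange_big/=; apply: eq_bigr => i _; rewrite mulr_suml.
by apply: eq_bigr => v _; ring.
Qed.

Section law.
Variables (e : 'I_d -> rvec R I) (s : 'I_d -> R).

(* The proof argument is what lets the probability structure be inferred. *)
Definition gaussian_comb of (forall i, s i != 0) : set (rvec R I) -> \bar R :=
  pushforward (gaussian_tuple s) (comb e).

Hypothesis s0 : forall i, s i != 0.

HB.instance Definition _ := Measure.copy (gaussian_comb s0)
  (pushforward_measure (gaussian_tuple s) (measurable_comb e)).

Let gaussian_comb_setT : gaussian_comb s0 setT = 1%E.
Proof. exact: gaussian_tuple_setT. Qed.

HB.instance Definition _ :=
  Measure_isProbability.Build _ _ _ (gaussian_comb s0) gaussian_comb_setT.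

Lemma gaussian_comb_dotv c (A : set mR) : measurable A ->
  gaussian_comb s0 [set h | A (dotv c h)] =
  normal_prob 0 1 [set z | A (Num.sqrt (\sum_i (dotv c (e i) * s i) ^+ 2) * z)].
Proof.
move=> mA; rewrite /gaussian_comb /pushforward -gaussian_tuple_lincomb//.
by congr (gaussian_tuple s _); apply/seteqP; split=> t; rewrite /preimage/= dotv_comb.
Qed.

End law.

Lemma prod_normal_pdf1 (t : d.-tuple mR) :
  \prod_(i < d) normal_pdf 0 1 (tnth t i) =
  normal_peak 1 ^+ d * expR (- (\sum_i tnth t i ^+ 2) / 2) :> R.
Proof.
under eq_bigr do rewrite normal_pdfE ?oner_neq0//.
rewrite big_split/= prodr_const card_ord; congr (_ * _).
rewrite -expR_sum; congr expR; rewrite mulNr mulr_suml -sumrN.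
by apply: eq_bigr => i _; rewrite subr0 expr1n mulNr.
Qed.

(** By orthonormality the density of the standard Gaussian at t is [G (comb e t)], with the same [G]
    for both families, so each side is the integral of f / G against a Gaussian law. The third
    hypothesis says that both families give every c the same projected length; it makes the
    variances of all linear forms equal. *)
Lemma lebesgue_comb_invariant e e' (f : rvec R I -> \bar R) :
  (forall i j, dotv (e i) (e j) = (i == j)%:R) ->
  (forall i j, dotv (e' i) (e' j) = (i == j)%:R) ->
  (forall c, \sum_i dotv c (e i) ^+ 2 = \sum_i dotv c (e' i) ^+ 2) ->
  measurable_fun setT f -> (forall h, (0 <= f h)%E) ->
  (\int[lebesgue_tuple R d]_t f (comb e t) =
   \int[lebesgue_tuple R d]_t f (comb e' t))%E.
Proof.
move=> on on' ee' mf f0.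
pose G (h : rvec R I) := normal_peak 1 ^+ d * expR (- dotv h h / 2) : R.
have G0 h : 0 < G h by rewrite mulr_gt0 ?expR_gt0// exprn_gt0// normal_peak_gt0 ?oner_neq0.
have mG : measurable_fun setT (fun h => ((G h)^-1)%:E).
  rewrite (_ : (fun h => _) = fun h => ((normal_peak 1 ^+ d)^-1 * expR (dotv h h / 2))%:E).
    apply/measurable_EFinP; apply: measurable_funM => //.
    apply: measurableT_comp => //; apply: measurable_funM => //.
    apply: measurable_sum => i; apply: measurable_funM;
      exact: measurable_rvec_coord.
  by apply/funext => h; rewrite /G invfM mulNr expRN invrK.
pose one (i : 'I_d) : R := 1.
have one0 i : one i != 0 by exact: oner_neq0.
have key x : (forall i j, dotv (x i) (x j) = (i == j)%:R) ->
  (\int[lebesgue_tuple R d]_t f (comb x t) =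
   \int[gaussian_comb x one0]_h (f h * ((G h)^-1)%:E))%E.
  move=> onx.
  have normE t : dotv (comb x t) (comb x t) = \sum_i tnth t i ^+ 2.
    rewrite dotv_comb; apply: eq_bigr => i _.
    have -> : dotv (comb x t) (x i) = dotv (x i) (comb x t).
      by apply: eq_bigr => v _; rewrite mulrC.
    rewrite dotv_comb (bigD1 i)//= onx eqxx mul1r big1 ?addr0// => j ji.
    by rewrite onx eq_sym (negbTE ji) mul0r.
  have mfG : measurable_fun setT (fun h => (f h * ((G h)^-1)%:E)%E).
    exact: emeasurable_funM.
  have fG0 h : (0 <= f h * ((G h)^-1)%:E)%E.
    by rewrite mule_ge0// lee_fin invr_ge0 ltW.
  rewrite (ge0_integral_pushforward (measurable_comb x))//= gaussian_tuple_density//.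
  - rewrite lebesgue_tupleE; apply: eq_integral => t _ /=; rewrite prod_normal_pdf1 -muleA -EFinM.
    by rewrite /G normE mulVf ?mule1// -normE gt_eqF//; exact: G0.
  - exact: (measurableT_comp mfG (measurable_comb x)).
rewrite !key//; apply: eq_measure_integral => A mA _.
apply: cramer_wold => // c B mB; apply: (etrans (gaussian_comb_dotv e one0 c mB)).
apply: (etrans _ (esym (gaussian_comb_dotv e' one0 c mB))).
congr (normal_prob 0 1 _); apply/seteqP.
have -> : \sum_i (dotv c (e i) * one i) ^+ 2 = \sum_i (dotv c (e' i) * one i) ^+ 2.
  under eq_bigr do rewrite mulr1.
  by under [RHS]eq_bigr do rewrite mulr1.
by split.
Qed.

End gaussian_combination.

(** * Fourier analysis on the discrete torus *)

Section fourier.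
Variables (R : realType) (n l : nat).
Local Notation L := l.+1.
Local Notation T := {ffun 'I_n -> 'I_L}.
Implicit Types (u v w z : T) (a b m : int).

(** The argument is an integer because [angle] is additive on integers. After [cos] or [sin] only
    the class modulo L counts, so arithmetic in the torus becomes arithmetic of congruences. *)
Definition angle m : R := 2 * pi * m%:~R / L%:R.

Let L_neq0 : L%:R != 0 :> R. Proof. by rewrite pnatr_eq0. Qed.

Lemma angleD a b : angle (a + b) = angle a + angle b.
Proof. by rewrite /angle intrD; field. Qed.

Lemma angleN a : angle (- a) = - angle a.
Proof. by rewrite /angle intrN; field. Qed.

Let periodic_angle (f : R -> R) a b : periodic f (pi *+ 2) ->
  (a = b %[mod L])%Z -> f (angle a) = f (angle b).
Proof.
move=> pf /eqP; rewrite eqz_mod_dvd => /dvdzP[k abk].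
have aE : angle a = angle b + angle (k * L%:Z).
  by rewrite -angleD -abk; congr angle; ring.
have kE : angle (k * L%:Z) = k%:~R * (pi *+ 2).
  by rewrite /angle intrM -mulr_natr; field.
rewrite {}aE {}kE; case: k {abk} => k.
  by rewrite -pmulrn mulr_natl (periodicn pf).
rewrite NegzE intrN mulNr -pmulrn mulr_natl.
by rewrite -[in RHS](subrK ((pi *+ 2) *+ k.+1) (angle b)) (periodicn pf).
Qed.

Lemma cos_angle_mod a b : (a = b %[mod L])%Z -> cos (angle a) = cos (angle b).
Proof. by apply: periodic_angle; exact: cosD2pi. Qed.

Lemma sin_angle_mod a b : (a = b %[mod L])%Z -> sin (angle a) = sin (angle b).
Proof. by apply: periodic_angle; exact: sinD2pi. Qed.

Lemma cos_angle_sin2 a : cos (angle a) = 1 - 2 * sin (pi * a%:~R / L%:R) ^+ 2.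
Proof.
rewrite (_ : angle a = (pi * a%:~R / L%:R) *+ 2); last by rewrite /angle -mulr_natr; field.
by rewrite cos_mulr2n cos2sin2 -mulr_natr; ring.
Qed.

Lemma sqr_sin_gt0 a : ~~ (L %| a)%Z -> 0 < sin (pi * a%:~R / L%:R : R) ^+ 2.
Proof.
move=> La.
(* The sine changes sign when a grows by L; its square is a function of [cos (angle a)], which is
   L-periodic. *)
have -> : sin (pi * a%:~R / L%:R : R) ^+ 2 = sin (pi * (a %% L)%Z%:~R / L%:R) ^+ 2.
  have := @cos_angle_mod a (a %% L)%Z; rewrite modz_mod => /(_ erefl).
  by rewrite !cos_angle_sin2 => /eqP; rewrite -subr_eq0 => /eqP; lra.
have r0 : (0 <= a %% L)%Z by rewrite modz_ge0.
have rn0 : (a %% L)%Z != 0 by apply: contra La => /eqP/dvdz_mod0P.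
have rL : ((a %% L)%Z < L%:Z)%R by rewrite ltz_pmod.
have rpos : 0 < (a %% L)%Z%:~R :> R by rewrite ltr0z lt_neqAle eq_sym rn0.
apply: exprn_gt0; apply: sin_gt0_pi; apply/andP; split.
  by rewrite divr_gt0// mulr_gt0// pi_gt0.
rewrite ltr_pdivrMr// ltr_pM2l ?pi_gt0//.
by rewrite -[L%:R]/((L%:Z)%:~R) ltr_int.
Qed.

Lemma cos_angle_lt1 a : ~~ (L %| a)%Z -> cos (angle a) < 1.
Proof. by move=> /sqr_sin_gt0 s0; rewrite cos_angle_sin2; lra. Qed.

Definition unit_step (j : 'I_n) : T := [ffun k => if k == j then inZp 1 else 0].

Definition tdot z v : int := \sum_k (z k)%:Z * (v k)%:Z.

Lemma tdotC z v : tdot z v = tdot v z.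
Proof. by apply: eq_bigr => k _; rewrite mulrC. Qed.

Lemma addT_mod v w k : (((v + w)%R k : 'I_L)%:Z = (v k)%:Z + (w k)%:Z %[mod L])%Z.
Proof. by rewrite ffunE -PoszD !modz_nat; congr Posz; exact: modn_mod. Qed.

Lemma oppT_mod v k : (((- v)%R k : 'I_L)%:Z = - (v k)%:Z %[mod L])%Z.
Proof.
apply/eqP; rewrite ffunE/= eqz_mod_dvd opprK -PoszD.
have := modnDml (L - v k) (v k) L; rewrite subnK ?modnn; last exact/ltnW.
by move=> h; rewrite dvdzE/= /dvdn; apply/eqP.
Qed.

Lemma unit_step_mod j k : ((unit_step j k)%:Z = (k == j)%:Z %[mod L])%Z.
Proof.
rewrite ffunE; case: eqP => _ //=; rewrite !modz_nat; congr Posz; exact: modn_mod.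
Qed.

Lemma sum_mod (I : finType) (F G : I -> int) :
  (forall i, (F i = G i %[mod L])%Z) -> (\sum_i F i = \sum_i G i %[mod L])%Z.
Proof.
move=> FG; apply/eqP; rewrite eqz_mod_dvd -sumrB.
by apply: rpred_sum => i _; rewrite -eqz_mod_dvd; exact/eqP.
Qed.

Lemma mul_mod a b b' : (b = b' %[mod L])%Z -> (a * b = a * b' %[mod L])%Z.
Proof.
by move=> /eqP; rewrite eqz_mod_dvd => h; apply/eqP; rewrite eqz_mod_dvd -mulrBr dvdz_mull.
Qed.

Lemma add_mod a a' b b' : (a = a' %[mod L])%Z -> (b = b' %[mod L])%Z ->
  (a + b = a' + b' %[mod L])%Z.
Proof. by move=> aa bb; rewrite -modzDm aa bb modzDm. Qed.

Section character_sums.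
Variable m : 'I_n -> int.
Let th v : int := \sum_k m k * (v k)%:Z.

Let th_shift v j : (th (v + unit_step j) = th v + m j %[mod L])%Z.
Proof.
have -> : th v + m j = \sum_k m k * ((v k)%:Z + (k == j)%:Z).
  under [RHS]eq_bigr do rewrite mulrDr.
  rewrite big_split/=; congr (_ + _).
  rewrite (bigD1 j)//= eqxx mulr1 big1 ?addr0// => k kj.
  by rewrite (negbTE kj) mulr0.
apply: sum_mod => k; apply: mul_mod; rewrite addT_mod.
by rewrite -modzDmr unit_step_mod modzDmr.
Qed.

Let S (f : R -> R) := \sum_v f (angle (th v)).

Let S_shift j (f : R -> R) : periodic f (pi *+ 2) ->
  S f = \sum_v f (angle (th v) + angle (m j)).
Proof.
move=> pf; rewrite /S (reindex_inj (addIr (unit_step j))).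
by apply: eq_bigr => v _; rewrite -angleD; apply: periodic_angle.
Qed.

(** Translating the summation variable along axis j rotates the vector (S cos, S sin) by
    [angle (m j)]. The vector is therefore fixed by a nontrivial rotation, and vanishes. *)
Lemma sum_character_eq0 j : ~~ (L %| m j)%Z -> S cos = 0 /\ S sin = 0.
Proof.
move=> /cos_angle_lt1 c1.
have h1 : S cos = S cos * cos (angle (m j)) - S sin * sin (angle (m j)).
  rewrite {1}(S_shift j (@cosD2pi _)) /S !mulr_suml -sumrB.
  by apply: eq_bigr => v _; rewrite cosD.
have h2 : S sin = S sin * cos (angle (m j)) + S cos * sin (angle (m j)).
  rewrite {1}(S_shift j (@sinD2pi _)) /S !mulr_suml -big_split.
  by apply: eq_bigr => v _; rewrite sinD.
move: h1 h2 c1 (cos2Dsin2 (angle (m j))).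
set c := cos _; set s := sin _; set X := S cos; set Y := S sin => h1 h2 c1 cs.
(* 2 (1 - c) = (1 - c)^2 + s^2 is the determinant of the identity minus the rotation; the two
   identities below are Cramer's rule. *)
have c10 : 2 * (1 - c) != 0 by rewrite gt_eqF//; lra.
split; apply: (mulfI c10); rewrite mulr0.
- have -> : 2 * (1 - c) * X = (1 - c) * (X - (X * c - Y * s)) - s * (Y - (Y * c + X * s))
      + X * (1 - (c ^+ 2 + s ^+ 2)) by ring.
  by rewrite -h1 -h2 cs; ring.
- have -> : 2 * (1 - c) * Y = (1 - c) * (Y - (Y * c + X * s)) + s * (X - (X * c - Y * s))
      + Y * (1 - (c ^+ 2 + s ^+ 2)) by ring.
  by rewrite -h1 -h2 cs; ring.
Qed.

(** Unlike the cosine sum, this one vanishes also for the trivial character, since then every angle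
    is a multiple of 2 pi. *)
Lemma sum_sin_character : S sin = 0.
Proof.
have [/existsP[j mj]|] := boolP [exists j, ~~ (L %| m j)%Z].
  by case: (sum_character_eq0 mj).
rewrite negb_exists => /forallP h; apply: big1 => v _.
rewrite (@sin_angle_mod _ 0); first by rewrite /angle mulr0 mul0r sin0.
apply/eqP; rewrite eqz_mod_dvd subr0; apply: rpred_sum => k _.
by apply: dvdz_mulr; have := h k; rewrite negbK.
Qed.

End character_sums.

(* The Hartley basis: [cas = cos + sin] gives one real eigenfunction per
   frequency, and the resulting matrix is symmetric. *)
Definition hartley z : rvec R T :=
  fun v => (Num.sqrt (L ^ n)%:R)^-1 * (cos (angle (tdot z v)) + sin (angle (tdot z v))).

Lemma hartleyC z v : hartley z v = hartley v z.
Proof. by rewrite /hartley tdotC. Qed.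

Let N_gt0 : 0 < (L ^ n)%:R :> R. Proof. by rewrite ltr0n expn_gt0. Qed.

(** The identity cas x cas y = cos(x - y) + sin(x + y). The cosine is the wanted term; the sine sums
    to 0 over points by [sum_sin_character], and over frequencies against an even weight. *)
Lemma hartleyM z w v : hartley z v * hartley w v = (L ^ n)%:R^-1 *
  (cos (angle (tdot z v - tdot w v)) + sin (angle (tdot z v + tdot w v))).
Proof.
rewrite /hartley mulrACA -invfM -expr2 sqr_sqrtr ?ltW//; congr (_ * _).
by rewrite !angleD angleN cosB sinD; ring.
Qed.

Lemma hartley_orthonormal z w : dotv (hartley z) (hartley w) = (z == w)%:R.
Proof.
rewrite /dotv; under eq_bigr do rewrite hartleyM.
rewrite -mulr_sumr big_split/=.
have -> : \sum_v sin (angle (tdot z v + tdot w v)) = 0 :> R.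
  rewrite -[RHS](sum_sin_character (fun k => (z k)%:Z + (w k)%:Z)).
  apply: eq_bigr => v _; congr (sin (angle _)); rewrite -big_split/=.
  by apply: eq_bigr => k _; rewrite mulrDl.
have thE v : tdot z v - tdot w v = \sum_k ((z k)%:Z - (w k)%:Z) * (v k)%:Z.
  by rewrite -sumrB; apply: eq_bigr => k _; rewrite mulrBl.
rewrite addr0; have [->|zw] := eqVneq z w.
  under eq_bigr do rewrite subrr /angle mulr0 mul0r cos0.
  by rewrite sumr_const card_ffun !card_ord mulVf// gt_eqF.
have [j zwj] : exists j, z j != w j.
  apply/existsP; apply: contraR zw; rewrite negb_exists => /forallP h.
  by apply/eqP/ffunP => j; apply/eqP; have := h j; rewrite negbK.
under eq_bigr do rewrite thE.
have [|-> _] := @sum_character_eq0 (fun k => (z k)%:Z - (w k)%:Z) j; last by rewrite mulr0.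
by rewrite -eqz_mod_dvd !modz_nat !modn_small.
Qed.

(** The Hartley matrix is symmetric, so its orthonormal rows are also orthonormal columns. *)
Lemma hartley_complete v u : \sum_z hartley z v * hartley z u = (v == u)%:R.
Proof.
rewrite -hartley_orthonormal; apply: eq_bigr => z _.
by rewrite !(hartleyC z).
Qed.

Lemma hartley_expansion (h : rvec R T) v :
  h v = \sum_z dotv (hartley z) h * hartley z v.
Proof.
rewrite /dotv; under eq_bigr do rewrite mulr_suml.
rewrite exchange_big/=.
transitivity (\sum_u (u == v)%:R * h u).
  by rewrite (bigD1 v)//= eqxx mul1r big1 ?addr0// => u /negbTE ->; rewrite mul0r.
apply: eq_bigr => u _; rewrite -hartley_complete mulr_suml.
by apply: eq_bigr => z _; ring.
Qed.

Lemma hartley0 v : hartley 0 v = (Num.sqrt (L ^ n)%:R)^-1.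
Proof.
rewrite /hartley /tdot big1 => [|k _]; last by rewrite ffunE mul0r.
by rewrite /angle mulr0 mul0r cos0 sin0 addr0 mulr1.
Qed.

Lemma groundedE (h : rvec R T) : grounded R n L h <-> dotv (hartley 0) h = 0.
Proof.
rewrite /grounded/= /dotv; under [X in _ <-> X = 0]eq_bigr do rewrite hartley0.
rewrite -mulr_sumr; split=> [->|/eqP]; first by rewrite mulr0.
by rewrite mulf_eq0 invr_eq0 sqrtr_eq0 leNgt N_gt0/= => /eqP.
Qed.

(** This is [lambda] read on the residues 0, ..., L - 1; [lambda_freq_rep] identifies the two. *)
Definition eigval z : R := 4 * L%:R ^+ 2 * \sum_k sin (pi * (z k)%:R / L%:R) ^+ 2.

Lemma eigval_gt0 z : z != 0 -> 0 < eigval z.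
Proof.
move=> z0; have [j zj] : exists j, z j != 0.
  apply/existsP; apply: contraR z0; rewrite negb_exists => /forallP h.
  by apply/eqP/ffunP => j; rewrite ffunE; apply/eqP; have := h j; rewrite negbK.
rewrite mulr_gt0 ?mulr_gt0 ?exprn_gt0 ?ltr0n//.
rewrite (bigD1 j)//= ltr_wpDr ?sumr_ge0// => [k _|]; first exact: sqr_ge0.
rewrite (_ : (z j)%:R = (z j)%:Z%:~R)//; apply: sqr_sin_gt0.
apply: contra zj => /dvdz_mod0P; rewrite modz_nat modn_small// => -[h].
by apply/eqP/val_inj.
Qed.

Lemma eigval0 : eigval 0 = 0.
Proof.
rewrite /eigval big1 ?mulr0// => k _.
by rewrite ffunE/= mulr0 mul0r sin0 expr0n.
Qed.

Lemma eigvalN z : eigval (- z) = eigval z.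
Proof.
rewrite /eigval; congr (_ * _); apply: eq_bigr => k _.
have c : cos (angle ((- z)%R k : 'I_L)%:Z) = cos (angle (z k)%:Z).
  by rewrite (cos_angle_mod (oppT_mod z k)) angleN cosN.
by move: c; rewrite !cos_angle_sin2 => /eqP; rewrite -subr_eq0 => /eqP; lra.
Qed.

End fourier.

Lemma small_congr_eq (x y r : int) (L : nat) : x - y = r * L%:Z ->
  (2 * absz x < L)%N -> (2 * absz y < L)%N -> x = y.
Proof.
move=> xy xL yL; suff r0 : r = 0 by move: xy; rewrite r0; lia.
have [r1|[r1|//]] : (1 <= r) \/ ((r <= -1) \/ r = 0) by lia.
  nia.
nia.
Qed.

(** * Nearest neighbours on the torus *)

Section adjacency.
Variables (R : realType) (n l : nat).
Local Notation L := l.+1.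
Local Notation T := {ffun 'I_n -> 'I_L}.
Implicit Types (u v w z : T) (a b m : int).

Let L_neq0 : L%:R != 0 :> R. Proof. by rewrite pnatr_eq0. Qed.

Lemma eq_modT u v : (forall k, ((u k)%:Z = (v k)%:Z %[mod L])%Z) -> u = v.
Proof.
move=> uv; apply/ffunP => k; have := uv k.
by rewrite !modz_nat !modn_small// => -[] /val_inj.
Qed.

(** The squared length of a lift of u - v, times L^2, is a natural number. Hence the infimum in
    [torus_dist] is attained, and adjacency means that the least value of [D] is 1. *)
Let D u v (m : {ffun 'I_n -> int}) : nat :=
  (\sum_k absz ((u k)%:Z - (v k)%:Z + L%:Z * m k)%R ^ 2)%N.

Let enormD u v (m : {ffun 'I_n -> int}) :
  enorm (fun k => tcoord R (u : torus n L) k - tcoord R (v : torus n L) k + (m k)%:~R : R) =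
  L%:R^-1 * Num.sqrt (D u v m)%:R.
Proof.
rewrite /enorm -[L%:R^-1]ger0_norm ?invr_ge0// -sqrtr_sqr -sqrtrM ?sqr_ge0//.
congr Num.sqrt; rewrite /D natr_sum mulr_sumr; apply: eq_bigr => k _.
rewrite natrX natr_absz intr_norm real_normK ?num_real//.
by rewrite /tcoord intrD intrB intrM -!pmulrn; field.
Qed.

Lemma torus_distE u v : exists m0 : {ffun 'I_n -> int},
  (forall m : {ffun 'I_n -> int}, (D u v m0 <= D u v m)%N) /\
  torus_dist R (u : torus n L) v = L%:R^-1 * Num.sqrt (D u v m0)%:R.
Proof.
have ex : exists k, `[< exists m : {ffun 'I_n -> int}, D u v m = k >].
  by exists (D u v (0 : {ffun 'I_n -> int})); apply/asboolP; exists 0.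
case: (ex_minnP ex) => k /asboolP[m0 m0k] kmin; exists m0.
have Dmin (m : {ffun 'I_n -> int}) : (D u v m0 <= D u v m)%N.
  by rewrite m0k; apply: kmin; apply/asboolP; exists m.
split=> //; rewrite /torus_dist; apply/eqP; rewrite eq_le; apply/andP; split.
- apply: ge_inf; last by exists m0 => //; rewrite enormD.
  by exists 0 => _ [m _ <-]; exact: sqrtr_ge0.
- apply: lb_le_inf; first by eexists; exists m0.
  move=> _ [m _ <-]; rewrite enormD ler_pM2l ?invr_gt0 ?ltr0n//.
  by rewrite ler_sqrt// ler_nat.
Qed.

Definition sgnb (s : bool) : int := if s then 1 else -1.

Definition signed_step (p : 'I_n * bool) : T :=
  if p.2 then unit_step l p.1 else - unit_step l p.1.

Lemma signed_step_mod p k :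
  ((signed_step p k)%:Z = sgnb p.2 * (k == p.1)%:Z %[mod L])%Z.
Proof.
rewrite /signed_step /sgnb; case: p => j [] /=.
  by rewrite mul1r unit_step_mod.
rewrite oppT_mod mulN1r; have := mul_mod (-1) (unit_step_mod l j k).
by rewrite !mulN1r.
Qed.

Lemma add_signed_step_mod v p k :
  (((v + signed_step p)%R k : 'I_L)%:Z = (v k)%:Z + sgnb p.2 * (k == p.1)%:Z %[mod L])%Z.
Proof. by rewrite addT_mod; apply: add_mod => //; exact: signed_step_mod. Qed.

Hypothesis l_gt1 : (1 < l)%N.

Let small m : (L %| m)%Z -> (absz m < 3)%N -> m = 0.
Proof.
rewrite dvdzE/= => Lm m3; apply/eqP; rewrite -absz_eq0.
apply/negPn/negP => m0; have : (0 < absz m)%N by rewrite lt0n.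
by move=> /dvdn_leq/(_ Lm); lia.
Qed.

(** Coordinates of two steps differ by at most 2, so congruence modulo L >= 3 forces equality. For L
    = 2 the steps in opposite directions would coincide and [sum_adjacent] would count a neighbour
    twice. *)
Lemma signed_step_inj : injective signed_step.
Proof.
move=> [i s] [j t] e; have := signed_step_mod (i, s) i.
rewrite e signed_step_mod/= eqxx mulr1 => /eqP.
rewrite eqz_mod_dvd => /small; case: eqVneq => [->|_]; rewrite /sgnb.
  by case: s {e}; case: t => //= /(_ isT).
by case: s {e}; case: t => //= /(_ isT).
Qed.

Lemma signed_step_neq0 p : signed_step p != 0.
Proof.
apply/eqP => e; have := signed_step_mod p p.1; rewrite e ffunE eqxx mulr1.
by move/eqP; rewrite eqz_mod_dvd => /small; rewrite /sgnb; case: p.2 => /= /(_ isT).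
Qed.

Lemma adjacentP u v :
  reflect (exists p, u = v + signed_step p) (Defs.adjacent R (u : torus n L) v).
Proof.
have Linv : L%:R^-1 != 0 :> R by rewrite invr_eq0.
apply: (iffP idP) => [|[p up]]; have [m0 [Dmin dE]] := torus_distE u v;
  rewrite /Defs.adjacent dE.
- rewrite -[X in _ == X]mulr1 => /eqP/(mulfI Linv) sq1.
  have D1 : D u v m0 = 1%N.
    apply/eqP; rewrite -(eqr_nat R) -[X in X == _]sqr_sqrtr//.
    by rewrite sq1 expr1n.
  pose x k : int := (u k)%:Z - (v k)%:Z + L%:Z * m0 k.
  have [k xk] : exists k, x k != 0.
    apply: contrapT => h; suff : D u v m0 = 0%N by rewrite D1.
    rewrite /D big1// => k _; suff : x k = 0 by rewrite /x => ->.
    by apply/eqP; apply: contrapT => /negP xk; apply: h; exists k.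
  (* A sum of integer squares equal to 1 has one entry 1 or -1, here at k, and zeros elsewhere. *)
  move: D1; rewrite /D (bigD1 k)//= -/(x k) => D1.
  have xk1 : absz (x k) = 1%N by move: xk; rewrite -absz_eq0; nia.
  move: D1; rewrite xk1 => -[] /eqP; rewrite sum_nat_eq0 => /forallP x0.
  exists (k, 0 < x k); apply: eq_modT => i; rewrite add_signed_step_mod/=.
  have xi : x i = sgnb (0 < x k) * (i == k)%:Z.
    have [->|ik] := eqVneq i k.
      by rewrite mulr1 /sgnb; case: ifP; lia.
    rewrite mulr0; apply/eqP; rewrite -absz_eq0.
    by have := x0 i; rewrite ik/= expn_eq0 andbT.
  rewrite -xi /x; apply/eqP; rewrite eqz_mod_dvd; apply/dvdzP; exists (- m0 i).
  by ring.
- have [m mE] : exists m : {ffun 'I_n -> int}, forall i,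
      (u i)%:Z - (v i)%:Z + L%:Z * m i = sgnb p.2 * (i == p.1)%:Z.
    have h i : exists q : int, (u i)%:Z - (v i)%:Z + L%:Z * q = sgnb p.2 * (i == p.1)%:Z.
      have := add_signed_step_mod v p i; rewrite -up => /eqP; rewrite eqz_mod_dvd.
      move=> /dvdzP[q uq]; exists (- q).
      rewrite mulrN [L%:Z * q]mulrC -uq; ring.
    exists [ffun i => projT1 (cid (h i))] => i; rewrite ffunE.
    exact: (projT2 (cid (h i))).
  have Dm : D u v m = 1%N.
    rewrite /D (bigD1 p.1)//= mE eqxx mulr1 big1 => [|i ip].
      by rewrite /sgnb; case: ifP.
    by rewrite mE (negbTE ip) mulr0.
  (* The lift [m] bounds the minimum by 1; the value 0 would give u = v, but a step is nonzero. *)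
  have D0 : D u v m0 != 0%N.
    apply/negP; rewrite sum_nat_eq0 => /forallP x0.
    have := signed_step_neq0 p; rewrite -[signed_step p](addKr v) -up.
    suff -> : u = v by rewrite addNr eqxx.
    apply: eq_modT => i; apply/eqP; rewrite eqz_mod_dvd; apply/dvdzP; exists (- m0 i).
    have := x0 i; rewrite /= expn_eq0 andbT absz_eq0 => /eqP; lia.
  have -> : D u v m0 = 1%N by have := Dmin m; lia.
  by rewrite sqrtr1 mulr1.
Qed.

Lemma sum_adjacent (F : T -> R) v :
  \sum_(u : torus n L | Defs.adjacent R u v) F u =
  \sum_k (F (v + unit_step l k) + F (v - unit_step l k)).
Proof.
pose g (p : 'I_n * bool) : T := v + signed_step p.
have g_inj : injective g by move=> p q /addrI/signed_step_inj.
transitivity (\sum_(u in imset g (mem predT)) F u).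
  apply: eq_bigl => u; apply/adjacentP/imsetP => [[p ->]|[p _ ->]];
    by exists p; rewrite ?inE.
rewrite big_imset/=; last by move=> p q _ _; exact: g_inj.
transitivity (\sum_(p : 'I_n * bool) F (g p)); first exact: eq_bigl.
rewrite -(pair_bigA _ (fun k s => F (v + signed_step (k, s))))/=.
by apply: eq_bigr => k _; rewrite big_bool.
Qed.

End adjacency.

(** * Spectrum of the discrete Laplacian and the covariance kernel *)

Section laplacian.
Variables (R : realType) (n l : nat).
Local Notation L := l.+1.
Local Notation T := {ffun 'I_n -> 'I_L}.
Local Notation hartley := (hartley R).
Local Notation eigval := (eigval R).
Local Notation N := (L ^ n)%N.
Implicit Types (u v w z : T).
Hypothesis L_odd : odd L.

Let opL (f : rvec R T) : rvec R T := - laplacian (n := n) (L := L) f.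

Let tdot_step z v p :
  (tdot z (v + signed_step l p) = tdot z v + sgnb p.2 * (z p.1)%:Z %[mod L])%Z.
Proof.
have -> : tdot z v + sgnb p.2 * (z p.1)%:Z =
    \sum_k (z k)%:Z * ((v k)%:Z + sgnb p.2 * (k == p.1)%:Z).
  under [RHS]eq_bigr do rewrite mulrDr.
  rewrite big_split/=; congr (_ + _).
  rewrite (bigD1 p.1)//= eqxx mulr1 big1 ?addr0; first by rewrite mulrC.
  by move=> k kp; rewrite (negbTE kp) !mulr0.
by apply: sum_mod => k; apply: mul_mod; exact: add_signed_step_mod.
Qed.

Let hartley_step z v k :
  (hartley z (v + unit_step l k) - hartley z v) + (hartley z (v - unit_step l k) - hartley z v) =
  - (4 * sin (pi * (z k)%:R / L%:R) ^+ 2) * hartley z v.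
Proof.
have c := cos_angle_sin2 R l (z k); rewrite -pmulrn in c.
have hp := tdot_step z v (k, true); have hm := tdot_step z v (k, false).
rewrite /hartley -[v + unit_step l k]/(v + signed_step l (k, true)).
rewrite -[v - unit_step l k]/(v + signed_step l (k, false)).
rewrite !(cos_angle_mod R hp) !(sin_angle_mod R hp) !(cos_angle_mod R hm) !(sin_angle_mod R hm).
rewrite /sgnb/= mul1r mulN1r !angleD angleN cosD cosB sinD sinB c; ring.
Qed.

Lemma laplacian_hartley z : opL (hartley z) = eigval z *: hartley z.
Proof.
apply/funext => v; rewrite /opL /laplacian.
have -> : (eigval z *: hartley z) v = eigval z * hartley z v by [].
have -> : (- (fun v0 : torus n L => L%:R ^+ 2 *
   \sum_(u | Defs.adjacent R u v0) (hartley z u - hartley z v0))) v =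
   - (L%:R ^+ 2 * \sum_(u : torus n L | Defs.adjacent R u v) (hartley z u - hartley z v)) by [].
(* For L = 1 the torus is a single point and both sides are 0; otherwise oddness gives L >= 3, as
   the description of neighbours requires. *)
have [l0|l_gt0] := posnP l.
  have T0 (u w : T) : u = w.
    apply/ffunP => k; apply/val_inj => /=.
    by have := ltn_ord (u k); have := ltn_ord (w k); lia.
  rewrite big1 => [|u _]; last by rewrite (T0 u v) subrr.
  by rewrite (T0 z 0) eigval0 mul0r mulr0 oppr0.
have l_gt1 : (1 < l)%N by case: (l) L_odd l_gt0 => [|[]].
rewrite (sum_adjacent l_gt1 (fun u => hartley z u - hartley z v)).
under eq_bigr do rewrite hartley_step.
by rewrite -mulr_suml sumrN -mulr_sumr /eigval; ring.
Qed.

Let opL_linear : linear opL.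
Proof.
move=> a f g; apply/funext => v.
have E h : opL h v = - (L%:R ^+ 2 * \sum_(u : torus n L | Defs.adjacent R u v) (h u - h v)) by [].
rewrite [RHS](_ : _ = a * opL f v + opL g v)// !E.
have -> : \sum_(u : torus n L | Defs.adjacent R u v) ((a *: f + g) u - (a *: f + g) v) =
    a * (\sum_(u : torus n L | Defs.adjacent R u v) (f u - f v)) +
    \sum_(u : torus n L | Defs.adjacent R u v) (g u - g v).
  rewrite mulr_sumr -big_split/=; apply: eq_bigr => u _.
  have S w : (a *: f + g) w = a * f w + g w by [].
  by rewrite !S; ring.
by ring.
Qed.

Definition hartley_multiplier (g : R -> R) (h : rvec R T) : rvec R T :=
  \sum_z (g (eigval z) * dotv (hartley z) h) *: hartley z.

Lemma dotvDZr (c h h' : rvec R T) a : dotv c (a *: h + h') = a * dotv c h + dotv c h'.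
Proof.
rewrite /dotv mulr_sumr -big_split/=; apply: eq_bigr => v _.
have -> : (a *: h + h') v = a * h v + h' v by [].
by rewrite mulrDr; congr (_ + _); exact: mulrCA.
Qed.

Lemma dotv_sumr (c : rvec R T) (I : finType) (x : I -> R) (e : I -> rvec R T) :
  dotv c (\sum_i x i *: e i) = \sum_i x i * dotv c (e i).
Proof.
rewrite /dotv; under [RHS]eq_bigr do rewrite mulr_sumr.
rewrite exchange_big/=; apply: eq_bigr => v _; rewrite fct_sumE mulr_sumr.
by apply: eq_bigr => i _; exact: mulrCA.
Qed.

Lemma dotv_hartley_multiplier g z h :
  dotv (hartley z) (hartley_multiplier g h) = g (eigval z) * dotv (hartley z) h.
Proof.
rewrite dotv_sumr (bigD1 z)//= hartley_orthonormal eqxx mulr1 big1 ?addr0//.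
by move=> w wz; rewrite hartley_orthonormal eq_sym (negbTE wz) mulr0.
Qed.

Lemma hartley_inj (f h : rvec R T) :
  (forall z, dotv (hartley z) f = dotv (hartley z) h) -> f = h.
Proof.
move=> fh; apply/funext => v; rewrite (hartley_expansion f) (hartley_expansion h).
by apply: eq_bigr => z _; rewrite fh.
Qed.

Let dotv_opL z h : dotv (hartley z) (opL h) = eigval z * dotv (hartley z) h.
Proof.
have -> : opL h = hartley_multiplier id h.
  have hE : h = \sum_w dotv (hartley w) h *: hartley w.
    by apply/funext => v; rewrite {1}hartley_expansion fct_sumE.
  pose A : {linear rvec R T -> rvec R T} := HB.pack opL (GRing.isLinear.Build _ _ _ _ _ opL_linear).
  rewrite {1}hE -[opL]/(A : _ -> _) linear_sum; apply: eq_bigr => w _.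
  by rewrite linearZ/= laplacian_hartley scalerA mulrC.
exact: dotv_hartley_multiplier.
Qed.

(** The multiplier is admissible: an eigenvector for lam has nonzero Hartley coefficients only where
    [eigval z = lam]. It is the only admissible operator, since the values on the Hartley functions
    determine a linear map. Hence the choice made by [get] is this one. *)
Lemma frac_laplacianE s :
  frac_laplacian (n := n) (L := L) s = hartley_multiplier (fun x => x `^ s).
Proof.
pose g (x : R) := x `^ s; pose P := [set B : rvec R T -> rvec R T | linear B /\
    forall (lam : R) (phi : rvec R T), opL phi = lam *: phi -> B phi = g lam *: phi].
have Pg : P (hartley_multiplier g).
  split=> [a f h|lam phi e]; apply: hartley_inj => z.
    by rewrite dotvDZr !dotv_hartley_multiplier dotvDZr; ring.
  rewrite dotv_hartley_multiplier.
  have scl (a : R) (f : rvec R T) : dotv (hartley z) (a *: f) = a * dotv (hartley z) f.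
    rewrite -[a *: f]addr0 dotvDZr [dotv _ 0]big1 ?addr0// => v _.
    by rewrite mulr0.
  have := dotv_opL z phi; rewrite e !scl => /eqP; rewrite -subr_eq0 -mulrBl mulf_eq0.
  by rewrite subr_eq0 => /orP[/eqP ->//|/eqP ->]; rewrite !mulr0.
have uniq B : P B -> B = hartley_multiplier g.
  move=> [linB Bg]; apply/funext => h.
  pose A : {linear rvec R T -> rvec R T} := HB.pack B (GRing.isLinear.Build _ _ _ _ _ linB).
  have hE : h = \sum_w dotv (hartley w) h *: hartley w.
    by apply/funext => v; rewrite {1}hartley_expansion fct_sumE.
  rewrite {1}hE -[B]/(A : _ -> _) linear_sum; apply: eq_bigr => w _.
  by rewrite linearZ/= (Bg _ _ (laplacian_hartley w)) scalerA mulrC.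
rewrite -(uniq (frac_laplacian (n := n) (L := L) s))//.
exact: (getPex (ex_intro P _ Pg)).
Qed.

(** The residue of least absolute value in each coordinate. As L is odd, the tie [2 * w k = L] does
    not occur, so the result lies in [ZL]. *)
Definition freq_rep w : {ffun 'I_n -> int} :=
  [ffun k => if (2 * w k < L)%N then (w k)%:Z else (w k)%:Z - L%:Z].

Let freq_rep_mod w k : (freq_rep w k = (w k)%:Z %[mod L])%Z.
Proof.
rewrite ffunE; case: ifP => // _; apply/eqP; rewrite eqz_mod_dvd.
by apply/dvdzP; exists (-1); ring.
Qed.

Let freq_rep_bij : set_bij [set` predC1 (0 : T)] (ZL n L `\ 0) freq_rep.
Proof.
have [q Lq] : exists q, L = (2 * q).+1.
  by exists L./2; rewrite -[LHS]odd_double_half L_odd -mul2n.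
have small w k : (2 * absz (freq_rep w k) < L)%N.
  by rewrite ffunE; have := ltn_ord (w k); move: (nat_of_ord (w k)) => a; case: ifP; lia.
have inj : injective freq_rep.
  move=> u v uv; apply: eq_modT => k.
  by rewrite -freq_rep_mod uv freq_rep_mod.
split.
- move=> w /= w0; split=> [k|]; first exact: small.
  move=> e; move/negP: w0; apply; apply/eqP/inj; rewrite e.
  by apply/ffunP => k; rewrite !ffunE.
- by move=> u v _ _; exact: inj.
(* The preimage is formed by the residues of z; two congruent integers of absolute value below L / 2
   are equal. *)
- move=> z [zZ z0]; pose w : T := [ffun k => inord (absz (z k %% L)%Z)].
  have wE k : (w k)%:Z = (z k %% L)%Z.
    rewrite ffunE inordK; first by rewrite gez0_abs// modz_ge0.
    by have := @ltz_pmod (z k) L isT; have := @modz_ge0 (z k) L isT; lia.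
  have wz : freq_rep w = z.
    apply/ffunP => k; have := zZ k; have := freq_rep_mod w k; rewrite wE modz_mod => /eqP.
    rewrite eqz_mod_dvd => /dvdzP[r rE].
    exact: small_congr_eq rE (small w k).
  exists w => //=; apply/negP => /eqP w0; apply: z0; rewrite /= -wz w0.
  by apply/ffunP => k; rewrite !ffunE.
Qed.

Lemma big_ZL (S : Type) (idx : S) (op : Monoid.com_law idx) (F : {ffun 'I_n -> int} -> S) :
  \big[op/idx]_(z \in ZL n L `\ 0) F z = \big[op/idx]_(w : T | w != 0) F (freq_rep w).
Proof.
rewrite (reindex_fsbig _ _ _ _ freq_rep_bij).
by rewrite -(@bigfs _ _ _ _ (index_enum T)) ?index_enum_uniq// => i _; rewrite mem_index_enum.
Qed.

Lemma lambda_freq_rep w : lambda R L (freq_rep w) = eigval w.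
Proof.
rewrite /lambda /eigval; congr (_ * _); apply: eq_bigr => k _.
have := cos_angle_mod R (freq_rep_mod w k).
rewrite !cos_angle_sin2 -pmulrn => /eqP; rewrite -subr_eq0 => /eqP; lra.
Qed.

(** A product of two Hartley functions contributes a cosine of the difference, which is the term of
    [kL], and a sine of the sum. The sines cancel between w and - w because [eigval] is even. *)
Lemma kL_hartley (v u : T) : kL R (v : torus n L) u =
  (a_ R n)^-1 * N%:R * \sum_(w : T | w != 0) eigval w `^ (- (n%:R / 2)) *
                          (hartley w v * hartley w u).
Proof.
rewrite /kL big_ZL -mulrA; congr (_ * _).
have N0 : N%:R != 0 :> R by rewrite pnatr_eq0 expn_eq0.
transitivity (\sum_(w : T | w != 0) eigval w `^ (- (n%:R / 2)) *
     cos (angle R l (tdot w v - tdot w u))).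
  apply: eq_bigr => w _; rewrite lambda_freq_rep; congr (_ * _).
  transitivity (cos (angle R l (\sum_k freq_rep w k * ((v k)%:Z - (u k)%:Z)))).
    congr cos; rewrite /angle rmorph_sum !mulr_sumr mulr_suml.
    apply: eq_bigr => k _; rewrite /tcoord /= intrM intrB -!pmulrn.
    by field.
  apply: cos_angle_mod; rewrite /tdot -sumrB; apply: sum_mod => k.
  rewrite -mulrBr ![_ * (_ - _)]mulrC; apply: mul_mod; exact: freq_rep_mod.
have sin0 : \sum_(w : T | w != 0) eigval w `^ (- (n%:R / 2)) *
     sin (angle R l (tdot w v + tdot w u)) = 0.
  set S := \sum_(_ | _) _.
  suff : S = - S by lra.
  rewrite {1}/S (reindex_inj (h := fun w : T => - w) oppr_inj)/= -sumrN; apply: eq_big => [w|w _].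
    by rewrite oppr_eq0.
  rewrite eigvalN; set e := _ `^ _; rewrite -mulrN -sinN -angleN; congr (_ * _).
  apply: sin_angle_mod; rewrite /tdot -!big_split/= -sumrN; apply: sum_mod => k.
  have -> : - ((w k)%:Z * (v k)%:Z + (w k)%:Z * (u k)%:Z) =
            ((v k)%:Z + (u k)%:Z) * - (w k)%:Z by ring.
  rewrite -mulrDr mulrC; apply: mul_mod; exact: oppT_mod.
rewrite -[LHS]addr0 -[X in _ + X]sin0 -big_split/= mulr_sumr.
by apply: eq_bigr => w _; rewrite !(hartleyC R w) hartleyM !(tdotC w); field.
Qed.

End laplacian.

(** * Positivity of a_n *)

Section gamma.
Variable R : realType.
Local Notation leb := (@lebesgue_measure R).

Let isq (t : R) := t `^ (- 2^-1).

Let d_sqrt (t : R) : 0 < t -> is_derive t 1 (fun t => 2 * t `^ 2^-1) (isq t).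
Proof.
move=> t0; have h := is_derive1_powR 2^-1 t0.
apply: is_derive_eq; rewrite /GRing.scale/= /isq.
by rewrite mulrA mulfV// mul1r; congr (_ `^ _); lra.
Qed.

Let cont_powR (a t : R) : 0 < t -> {for t, continuous (fun t : R => t `^ a)}.
Proof.
move=> t0; apply/differentiable_continuous/derivable1_diffP.
by have h := is_derive1_powR a t0; apply: ex_derive.
Qed.

(** The shift by 2 keeps the left end strictly between 0 and 1, as the fundamental theorem of
    calculus needs; the bound is uniform in i. *)
Let integral_isq_le (i : nat) :
  (\int[leb]_(t in `[(i.+2%:R^-1)%R, 1%R]) (isq t)%:E <= 2%:E)%E.
Proof.
set a := i.+2%:R^-1; have a0 : 0 < a by rewrite invr_gt0.
have a1 : a < 1 by rewrite invf_lt1// ltr1n.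
have pos t : t \in `[a, 1] -> 0 < t by rewrite in_itv/= => /andP[/(lt_le_trans a0)].
have cG t : 0 < t -> {for t, continuous (fun t : R => 2 * t `^ 2^-1)}.
  by move=> t0; apply: cvgMr; exact: cont_powR.
rewrite (@continuous_FTC2 _ isq (fun t => 2 * t `^ 2^-1))//.
- by rewrite powR1 mulr1 -EFinB lee_fin gerBl mulr_ge0// powR_ge0.
- apply: continuous_in_subspaceT => t /set_mem ta; apply: cont_powR.
  by apply: pos; exact: ta.
- split.
  + move=> t ta; have t0 : 0 < t by apply: pos; apply: subset_itv_oo_cc.
    by have h := d_sqrt t0; apply: ex_derive.
  + by apply: cvg_at_right_filter; apply: cG.
  + by apply: cvg_at_left_filter; apply: cG.
- move=> t ta; have t0 : 0 < t by apply: pos; apply: subset_itv_oo_cc.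
  by rewrite derive1E; apply: derive_val; exact: d_sqrt.
Qed.

Let integral_isq : (\int[leb]_(t in `]0%R, 1%R]) (isq t)%:E <= 2%:E)%E.
Proof.
pose F (i : nat) := `[(i.+2%:R^-1 : R)%R, 1%R]%classic.
have -> : `]0%R, 1%R]%classic = \bigcup_i F i.
  apply/seteqP; split=> t; rewrite /F/= in_itv/=.
    move=> /andP[t0 t1]; exists (Num.bound t^-1) => //=; rewrite in_itv/= t1 andbT.
    rewrite invf_ple ?posrE//; apply/ltW/(lt_le_trans (archi_boundP _)).
      by rewrite invr_ge0 ltW.
    by rewrite ler_nat -addn2 leq_addr.
  move=> [i _] /=; rewrite in_itv/= => /andP[ti ->]; rewrite andbT.
  by apply: lt_le_trans ti; rewrite invr_gt0.
have misq : measurable_fun setT isq by exact: measurable_powR.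
have cv : (\int[leb]_(t in F i) (isq t)%:E @[i --> \oo] -->
          \int[leb]_(t in \bigcup_i F i) (isq t)%:E)%E.
  apply: ge0_nondecreasing_set_cvg_integral.
  - apply/nondecreasing_seqP => i; apply/subsetPset => t; rewrite /F/= !in_itv/=.
    move=> /andP[ti ->]; rewrite andbT; apply: le_trans ti.
    by rewrite lef_pV2 ?posrE// ler_nat.
  - by move=> i; exact: measurable_itv.
  - by move=> i; apply/measurable_EFinP; exact: measurable_funTS.
  - by move=> i t _; rewrite lee_fin powR_ge0.
rewrite -(cvg_lim _ cv)//; apply: lime_le; first by apply/cvg_ex; eexists; exact: cv.
by apply: nearW => i; exact: integral_isq_le.
Qed.

(** Take y = t / (2 k) in 1 + y <= exp y, and raise t <= 2 k exp y to the power k. *)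
Let powR_le_exp (k : nat) (t : R) : (0 < k)%N -> 0 <= t ->
  t ^+ k <= (2 * k%:R) ^+ k * expR (t / 2).
Proof.
move=> k0 t0; have k0' : 0 < k%:R :> R by rewrite ltr0n.
have -> : t / 2 = k%:R * (t / (2 * k%:R)) by field; rewrite gt_eqF.
rewrite expRM_natl -exprMn; apply: lerXn2r => //.
  by rewrite nnegrE mulr_ge0 ?expR_ge0// mulr_ge0.
have := expR_ge1Dx (t / (2 * k%:R)); set y := t / _ => ey.
have -> : t = (2 * k%:R) * y by rewrite /y; field; rewrite gt_eqF.
by rewrite ler_pM2l ?mulr_gt0//; lra.
Qed.

(** [fine] sends an infinite integral to 0, so positivity needs an upper bound on the integral as
    well as a lower one. The bound 1/2 is n / 2 at n = 1; it makes t^(-1/2) a majorant near 0. *)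
Lemma Gamma_gt0 (x : R) : 2^-1 <= x -> 0 < Gamma x.
Proof.
move=> x2; have x0 : 0 < x by apply: lt_le_trans x2.
pose f (t : R) := t `^ (x - 1) * expR (- t).
have mf : measurable_fun setT f.
  by apply: measurable_funM; [exact: measurable_powR|exact: measurableT_comp].
have f0 t : 0 <= f t by rewrite mulr_ge0 ?powR_ge0 ?expR_ge0.
rewrite /Gamma /Rintegral; apply: fine_gt0; apply/andP; split.
(* On [1, 2] one has t^(x - 1) >= t^(-1) >= 1/2 and exp(- t) >= exp(- 2). *)
- apply: (@lt_le_trans _ _ (\int[leb]_(t in `[1%R, 2%R]) (2^-1 * expR (- 2))%:E)%E).
    rewrite integral_cst//= lebesgue_measure_itv/= lte_fin ltr1n/= -EFinB -EFinM lte_fin.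
    by rewrite mulr_gt0 ?mulr_gt0 ?expR_gt0//; lra.
  apply: (@le_trans _ _ (\int[leb]_(t in `[1%R, 2%R]) (f t)%:E)%E).
    apply: ge0_le_integral => //=.
    - by apply/measurable_EFinP; exact: measurable_funTS.
    - move=> t; rewrite in_itv/= => /andP[t1 t2]; rewrite lee_fin ler_pM ?expR_ge0//.
        apply: (@le_trans _ _ (t `^ (- 1))); last by apply: ler_powR => //; lra.
        by rewrite powR_inv1 ?lef_pV2 ?posrE//; lra.
      by rewrite ler_expR lerN2.
  apply: ge0_subset_integral => //=.
  - by apply/measurable_EFinP; exact: measurable_funTS.
  - by move=> t _; rewrite lee_fin.
  - by move=> t/=; rewrite !in_itv/= andbT => /andP[t1 _]; lra.
- pose k := Num.bound x; have xk : x < k%:R by apply: archi_boundP; exact: ltW.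
  have k0 : (0 < k)%N by rewrite -(ltr0n R); exact: lt_trans xk.
  pose K : R := (2 * k%:R) ^+ k.
  have K0 : 0 <= K by rewrite exprn_ge0// mulr_ge0.
  pose g1 (t : R) : \bar R := ((fun t => (isq t)%:E) \_ `]0%R, 1%R]) t.
  (* The factor 2 cancels the rate 1/2 of the density, so that g2 t = K exp(- t / 2) for t > 0. *)
  pose g2 (t : R) : \bar R := (2 * K * exponential_pdf 2^-1 t)%:E.
  have mg1 : measurable_fun setT g1.
    rewrite /g1; apply/(measurable_restrictT _ (measurable_itv _)); apply/measurable_EFinP.
    apply: measurable_funTS.
    exact: measurable_powR.
  have mg2 : measurable_fun setT g2.
    apply/measurable_EFinP; apply: measurable_funM => //.
    exact: measurable_exponential_pdf.
  have g10 t : (0 <= g1 t)%E by rewrite /g1 patchE; case: ifP => // _; rewrite lee_fin powR_ge0.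
  have half0 : 0 < 2^-1 :> R by rewrite invr_gt0.
  have pdf0 t : 0 <= exponential_pdf (2^-1 : R) t by apply: exponential_pdf_ge0; exact: ltW.
  have g20 t : (0 <= g2 t)%E by rewrite lee_fin !mulr_ge0.
  apply: (@le_lt_trans _ _ (\int[leb]_t (g1 t + g2 t))%E); last first.
    rewrite ge0_integralD//; apply: lte_add_pinfty.
      apply: (@le_lt_trans _ _ 2%:E%E); last exact: ltry.
      by rewrite /g1 -integral_mkcond; exact: integral_isq.
    under eq_integral do rewrite /g2 EFinM.
    rewrite ge0_integralZl//=; last 3 first.
    - by apply/measurable_EFinP; exact: measurable_exponential_pdf.
    - by move=> t _; rewrite lee_fin.
    - by rewrite lee_fin mulr_ge0.
    by rewrite integral_exponential_pdf// mule1 ltry.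
  rewrite integral_mkcond; apply: ge0_le_integral => //.
  - by move=> t _; rewrite patchE; case: ifP => // _; rewrite lee_fin; exact: f0.
  - apply/(measurable_restrictT _ (measurable_itv _)); apply/measurable_EFinP.
    exact: (measurable_funTS mf).
  - exact: emeasurable_funD.
  - move=> t _; rewrite patchE; case: ifPn => [|_]; last by rewrite adde_ge0.
    rewrite inE/= in_itv/= andbT => t0.
    have g2E : g2 t = (K * expR (- (t / 2)))%:E.
      rewrite /g2 exponential_pdfE ?ltW//; congr EFin.
      by rewrite (_ : - 2^-1 * t = - (t / 2)); [field|ring].
    have [t1|t1] := leP t 1.
      rewrite -[leLHS]adde0 leeD// /g1 patchE mem_set/=; last by rewrite in_itv/= t0 t1.
      rewrite lee_fin -[leRHS]mulr1 ler_pM ?powR_ge0 ?expR_ge0//.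
        by apply: ger_powR; [rewrite t0|lra].
      by rewrite -expR0 ler_expR oppr_le0 ltW.
    rewrite -[leLHS]add0e leeD// g2E lee_fin.
    rewrite (_ : - t = t / 2 * -1 - t / 2); last by field.
    rewrite mulrN1 expRD mulrA ler_wpM2r ?expR_ge0//.
    apply: (@le_trans _ _ (t ^+ k * expR (- (t / 2)))).
      rewrite ler_wpM2r ?expR_ge0// -powR_mulrn; last exact: ltW.
      by apply: ler_powR; [exact: ltW|lra].
    rewrite expRN ler_pdivrMr ?expR_gt0//.
    by apply: powR_le_exp => //; exact: ltW.
Qed.

Lemma a_gt0 (n : nat) : (0 < n)%N -> 0 < a_ R n.
Proof.
move=> n0; rewrite /a_ divr_gt0// mulr_gt0 ?powR_gt0 ?mulr_gt0 ?pi_gt0//.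
by apply: Gamma_gt0; rewrite ler_pdivlMr// mulVf// ler1n.
Qed.

End gamma.

(** * The polyharmonic field *)

Section same_law.
Variable R : realType.
Local Notation mR := (measurableTypeR R).
Local Notation N1 := (normal_prob (0 : R) 1).

Lemma integral_same_law d1 d2 (V : measurableType d1) (W : measurableType d2)
    (P : {measure set V -> \bar R}) (Q : {measure set W -> \bar R})
    (Y : V -> mR) (Z : W -> mR) (g : R -> R) :
  measurable_fun setT Y -> measurable_fun setT Z -> measurable_fun setT g ->
  (forall A : set mR, measurable A -> P (Y @^-1` A) = Q (Z @^-1` A)) ->
  Q.-integrable setT (fun w => (g (Z w))%:E) ->
  P.-integrable setT (fun v => (g (Y v))%:E) /\
  (\int[P]_v (g (Y v))%:E = \int[Q]_w (g (Z w))%:E)%E.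
Proof.
move=> mY mZ mg YZ intZ.
have law (f : R -> \bar R) :
    (\int[pushforward_measure P mY]_y f y = \int[pushforward_measure Q mZ]_y f y)%E.
  by apply: eq_measure_integral => A mA _; exact: YZ.
have mgE : measurable_fun setT (fun y => (g y)%:E) by exact/measurable_EFinP.
have mgabs : measurable_fun setT (fun y : mR => `|(g y)%:E|%E).
  exact: (measurableT_comp _ mgE).
have intY : P.-integrable setT (fun v => (g (Y v))%:E).
  apply/integrableP; split; first exact: (measurableT_comp mgE mY).
  move/integrableP : intZ => [_]; apply: le_lt_trans.
  have := law (fun y => `|(g y)%:E|%E).
  rewrite (ge0_integral_pushforward mY)// (ge0_integral_pushforward mZ)//.
  by rewrite !preimage_setT => <-.
split=> //; have := law (fun y => (g y)%:E).
rewrite (integral_pushforward mY)// (integral_pushforward mZ)//.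
Qed.

(** The moments of [N1] are carried through the affine form of the law, which includes [s = 0].
    Integrability is part of the conclusion because an abstract field offers no other source for
    it. *)
Lemma gaussian_moments d (V : measurableType d) (P : {measure set V -> \bar R})
    (Y : V -> mR) (m s : R) : measurable_fun setT Y ->
  (forall A : set mR, measurable A -> P (Y @^-1` A) = gaussian_law m s A) ->
  [/\ P.-integrable setT (fun v => (Y v)%:E), (\int[P]_v (Y v)%:E = m%:E)%E,
      P.-integrable setT (fun v => (Y v ^+ 2)%:E) &
      (\int[P]_v (Y v ^+ 2)%:E = (m ^+ 2 + s ^+ 2)%:E)%E].
Proof.
move=> mY lawY; have maff := measurable_affine m s.
have law (A : set mR) : measurable A ->
    P (Y @^-1` A) = N1 ((fun z : mR => m + s * z : mR) @^-1` A).
  by move=> mA; rewrite lawY// gaussian_lawE.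
have i1 := integrable_normal_id R; have i2 := integrable_normal_sqr R.
have ic (k : R) : N1.-integrable setT (fun _ : R => k%:E).
  exact: finite_measure_integrable_cst.
have is1 (k : R) : N1.-integrable setT (fun z : R => (k%:E * z%:E)%E).
  exact: integrableZl.
have is2 (k : R) : N1.-integrable setT (fun z : R => (k%:E * (z ^+ 2)%:E)%E).
  exact: integrableZl.
have cst (k : R) : (\int[N1]_z k%:E = k%:E)%E.
  by rewrite integral_cst//= probability_setT mule1.
have affE : (fun z : R => (m + s * z)%:E) = (fun z => m%:E + s%:E * z%:E)%E.
  by apply/funext => z; rewrite EFinD EFinM.
have sqE : (fun z : R => ((m + s * z) ^+ 2)%:E) =
    (fun z => (m ^+ 2)%:E + (2 * m * s)%:E * z%:E + (s ^+ 2)%:E * (z ^+ 2)%:E)%E.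
  by apply/funext => z; rewrite -!EFinM -!EFinD; congr EFin; ring.
have [] := @integral_same_law _ _ _ _ P N1 Y _ id mY maff (@measurable_id _ _ _) law.
  by rewrite affE; exact: integrableD.
move=> iY ->; rewrite affE.
have [] := @integral_same_law _ _ _ _ P N1 Y _ (fun y => y ^+ 2) mY maff
   (@exprn_measurable _ _ 2) law.
  by rewrite sqE; apply: integrableD => //; exact: integrableD.
move=> iY2 ->; rewrite sqE; split => //.
- rewrite integralD//= integralZl//= normal_first_moment mule0 adde0.
  exact: cst.
- rewrite integralD//=; last exact: integrableD.
  rewrite integralD//= !integralZl//= normal_first_moment normal_second_moment.
  by rewrite mule0 adde0 mule1 cst EFinD.
Qed.

End same_law.

Section nonzero_enum.
Variables n l : nat.
Local Notation T := {ffun 'I_n -> 'I_l.+1}.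

(** The index type is that of [grounded_onb], so that an arbitrary grounded basis and the nonzero
    Hartley functions are related by a square matrix. *)
Lemma nonzero_enum : exists f : 'I_(l.+1 ^ n).-1 -> T,
  [/\ injective f, forall i, f i != 0 & forall w, w != 0 -> exists i, f i = w].
Proof.
have cardE : (l.+1 ^ n).-1 = #|[pred w : T | w != 0]|.
  have <- : #|{: T}| = (l.+1 ^ n)%N by rewrite card_ffun !card_ord.
  rewrite (cardD1 (0 : T)) inE add1n /=.
  by apply: eq_card => w; rewrite !inE andbT.
exists (fun i => enum_val (cast_ord cardE i)); split.
- by move=> i j /enum_val_inj/cast_ord_inj.
- by move=> i; have := enum_valP (cast_ord cardE i).
- move=> w w0; have w0' : w \in [pred w : T | w != 0] by [].
  exists (cast_ord (esym cardE) (enum_rank_in w0' w)).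
  by rewrite cast_ordKV enum_rankK_in.
Qed.

End nonzero_enum.

(** * Laws on the grounded fields *)

Section main.
Variables (R : realType) (n l : nat).
Hypothesis n_gt0 : (0 < n)%N.
Hypothesis L_odd : odd l.+1.
Local Notation L := l.+1.
Local Notation N := (L ^ n)%N.
Local Notation d := (L ^ n).-1.
Local Notation T := {ffun 'I_n -> 'I_L}.
Local Notation RT := (rvec R (torus n L)).
Local Notation mR := (measurableTypeR R).
Local Notation hartley := (hartley R).
Local Notation eigval := (eigval R).
Local Notation a := (a_ R n).

Variable freq : 'I_d -> T.
Hypothesis freq_inj : injective freq.
Hypothesis freq_neq0 : forall i, freq i != 0.
Hypothesis freq_onto : forall w, w != 0 -> exists i, freq i = w.

(** [mu] lists the eigenvalues of the n / 4 power of minus the Laplacian on the family [b]; [sig]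
    and [sqN] are the standard deviations of the coordinates in [b] under [nu] and under the white
    noise, the latter a constant family. *)
Let b (i : 'I_d) : RT := hartley (freq i).
Let mu (i : 'I_d) : R := eigval (freq i) `^ (n%:R / 4).
Let sig (i : 'I_d) : R := Num.sqrt N%:R / (Num.sqrt a * mu i).
Let sqN (i : 'I_d) : R := Num.sqrt N%:R.

Let a0 : 0 < a. Proof. exact: a_gt0. Qed.
Let sqa0 : 0 < Num.sqrt a. Proof. by rewrite sqrtr_gt0. Qed.
Let N0 : 0 < N%:R :> R. Proof. by rewrite ltr0n expn_gt0. Qed.
Let sqN0 : 0 < Num.sqrt N%:R :> R. Proof. by rewrite sqrtr_gt0. Qed.
Let mu0 i : 0 < mu i. Proof. by rewrite powR_gt0// eigval_gt0. Qed.
Let sig0 i : 0 < sig i. Proof. by rewrite divr_gt0// mulr_gt0. Qed.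
Let sig_neq0 i : sig i != 0. Proof. by rewrite gt_eqF. Qed.
Let sqN_neq0 i : sqN i != 0. Proof. by rewrite gt_eqF. Qed.

Lemma big_freq (S : Type) (idx : S) (op : Monoid.com_law idx) (F : T -> S) :
  \big[op/idx]_(w : T | w != 0) F w = \big[op/idx]_i F (freq i).
Proof.
transitivity (\big[op/idx]_(w in imset freq (mem predT)) F w).
  apply: eq_bigl => w; apply/idP/imsetP => [/freq_onto[i <-]|[i _ ->]//].
  by exists i.
rewrite big_imset/=; last by move=> i j _ _; exact: freq_inj.
exact: eq_bigl.
Qed.

Lemma sum_hartley_freq (F : T -> R) : F 0 = 0 -> \sum_z F z = \sum_i F (freq i).
Proof. by move=> F0; rewrite (bigD1 (0 : T))//= F0 add0r big_freq. Qed.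

Let b_orthonormal i j : dotv (b i) (b j) = (i == j)%:R.
Proof. by rewrite hartley_orthonormal (inj_eq freq_inj). Qed.

Let grounded_b i : grounded R n L (b i).
Proof. by apply/groundedE; rewrite hartley_orthonormal eq_sym (negbTE (freq_neq0 i)). Qed.

Lemma grounded_expansion (h : RT) : grounded R n L h ->
  h = \sum_i dotv (b i) h *: b i.
Proof.
move=> /groundedE h0; apply/funext => v; rewrite {1}hartley_expansion fct_sumE.
by rewrite (sum_hartley_freq (F := fun z => dotv (hartley z) h * hartley z v))// h0 mul0r.
Qed.

(* The transition matrix M between the two orthonormal families satisfies
   M M^T = 1, hence M^T M = 1. *)
Lemma parseval_onb (e : 'I_d -> RT) c : grounded_onb R n L e ->
  \sum_i dotv c (e i) ^+ 2 = \sum_i dotv c (b i) ^+ 2.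
Proof.
move=> [ge oe]; pose M : 'M[R]_d := \matrix_(i, j) dotv (b j) (e i).
have dE x i : dotv x (e i) = \sum_j M i j * dotv x (b j).
  rewrite {1}(grounded_expansion (ge i)) dotv_sumr.
  by apply: eq_bigr => j _; rewrite mxE.
have MMt : M *m M^T = 1%:M.
  apply/matrixP => i j; rewrite !mxE -oe dE.
  apply: eq_bigr => k _; rewrite !mxE mulrC; congr (_ * _).
  by apply: eq_bigr => v _; rewrite mulrC.
have MtM := mulmx1C MMt.
pose y : 'cV[R]_d := \col_j dotv c (b j).
transitivity (((M *m y)^T *m (M *m y)) 0 0).
  rewrite mxE; apply: eq_bigr => i _; rewrite !mxE expr2.
  have -> : \sum_j M i j * y j 0 = dotv c (e i).
    by rewrite dE; apply: eq_bigr => j _; rewrite !mxE.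
  by [].
rewrite trmx_mul -mulmxA (mulmxA M^T) MtM mul1mx mxE.
by apply: eq_bigr => i _; rewrite !mxE expr2.
Qed.

(** [b] witnesses that an orthonormal basis exists, so [get] does return one; invariance then
    replaces this unknown basis by [b]. *)
Lemma integral_lebesgue_grounded (f : RT -> \bar R) :
  measurable_fun setT f -> (forall h, (0 <= f h)%E) ->
  (\int[lebesgue_grounded R n L]_h f h = \int[lebesgue_tuple R d]_t f (comb b t))%E.
Proof.
move=> mf f0; have onb : grounded_onb R n L b by split.
have [ge oe] : grounded_onb R n L (get (grounded_onb R n L)).
  exact: (getPex (ex_intro _ b onb)).
rewrite /lebesgue_grounded /=.
have onb' : grounded_onb R n L (get (grounded_onb R n L)) by split.
set e := get _ in ge oe onb' *.
transitivity (\int[lebesgue_tuple R d]_t f (comb e t))%E.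
  by rewrite lebesgue_tupleE (ge0_integral_pushforward (measurable_comb e)).
by apply: lebesgue_comb_invariant => // c; exact: parseval_onb.
Qed.

Lemma density_gaussian_comb (s : 'I_d -> R) (s0 : forall i, s i != 0) (q : RT -> R) A :
  measurable_fun setT q -> (forall h, 0 <= q h) ->
  (forall t, q (comb b t) = \prod_i normal_pdf 0 (s i) (tnth t i)) -> measurable A ->
  (\int[lebesgue_grounded R n L]_(h in A) (q h)%:E = gaussian_comb b s0 A)%E.
Proof.
move=> mq q0 qE mA.
transitivity (\int[lebesgue_grounded R n L]_h ((EFin \o q) \_ A) h)%E.
  by rewrite /integral/= patch_setT.
rewrite integral_lebesgue_grounded; last 2 first.
- by apply/(measurable_restrictT _ mA)/measurable_EFinP; exact: measurable_funTS.
- by move=> h; rewrite patchE; case: ifP => // _; rewrite lee_fin.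
have mB : measurable (comb b @^-1` A).
  by rewrite -[X in measurable X]setTI; exact: measurable_comb.
rewrite /gaussian_comb /pushforward -[RHS]/(gaussian_tuple s (comb b @^-1` A)).
rewrite -[comb b @^-1` A]setIT -integral_indic// gaussian_tuple_density; last 2 first.
- by apply/measurable_EFinP; exact: measurable_indic.
- by move=> t; rewrite lee_fin.
rewrite lebesgue_tupleE; apply: eq_integral => t _; rewrite patchE indicE -qE.
have -> : (t \in comb b @^-1` A) = (comb b t \in A) by apply/idP/idP; rewrite !inE.
by case: ifP; rewrite ?mul1e ?mul0e.
Qed.

Let dotv_hartley_comb i t : dotv (hartley (freq i)) (comb b t) = tnth t i.
Proof.
rewrite dotv_comb (bigD1 i)//= -[hartley (freq i)]/(b i) b_orthonormal eqxx mul1r.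
rewrite big1 ?addr0// => j ji.
by rewrite b_orthonormal eq_sym (negbTE ji) mul0r.
Qed.

Lemma grounded_comb t : grounded R n L (comb b t).
Proof.
apply/groundedE; rewrite dotv_comb big1// => i _.
by rewrite hartley_orthonormal eq_sym (negbTE (freq_neq0 i)) mul0r.
Qed.

Lemma enormE (h : RT) : enorm h ^+ 2 = \sum_z dotv (hartley z) h ^+ 2.
Proof.
rewrite /enorm sqr_sqrtr; last by apply: sumr_ge0 => v _; exact: sqr_ge0.
transitivity (dotv h (\sum_z dotv (hartley z) h *: hartley z)).
  apply: eq_bigr => v _; rewrite expr2; congr (_ * _).
  by rewrite {1}hartley_expansion fct_sumE.
rewrite dotv_sumr; apply: eq_bigr => z _; rewrite expr2; congr (_ * _).
by apply: eq_bigr => v _; rewrite mulrC.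
Qed.

Lemma enorm_comb t : enorm (comb b t) ^+ 2 = \sum_i tnth t i ^+ 2.
Proof.
rewrite enormE sum_hartley_freq; last first.
  by have /groundedE -> := grounded_comb t; rewrite expr0n.
by apply: eq_bigr => i _; rewrite dotv_hartley_comb.
Qed.

(** Since 0 raised to the power 0 is 1 for [powR], the fractional Laplacian kills constants only
    because its exponent is nonzero. *)
Let n4 : n%:R / 4 != 0 :> R.
Proof. by rewrite mulf_neq0// ?invr_eq0 pnatr_eq0// -lt0n. Qed.

Lemma enorm_frac_comb t :
  enorm (frac_laplacian (n := n) (L := L) (n%:R / 4) (comb b t)) ^+ 2 =
  \sum_i (mu i * tnth t i) ^+ 2.
Proof.
rewrite frac_laplacianE// enormE sum_hartley_freq; last first.
  by rewrite dotv_hartley_multiplier eigval0 powR0// mul0r expr0n.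
by apply: eq_bigr => i _; rewrite dotv_hartley_multiplier dotv_hartley_comb.
Qed.

Lemma measurable_hartley_multiplier g :
  measurable_fun setT (hartley_multiplier (R := R) (n := n) (l := l) g : RT -> RT).
Proof.
apply: measurable_rvec => v.
rewrite (_ : (fun h => _) = fun h : RT =>
   \sum_z (g (eigval z) * dotv (hartley z) h) * hartley z v); last first.
  by apply/funext => h; rewrite /hartley_multiplier fct_sumE.
apply: measurable_sum => z; apply: measurable_funM => //; apply: measurable_funM => //.
exact: measurable_dotv.
Qed.

Lemma measurable_enorm : measurable_fun setT (@enorm R (torus n L)).
Proof.
apply: (measurableT_comp (@continuous_measurable_fun R Num.sqrt (@sqrt_continuous R))).
apply: measurable_sum => v; apply: measurable_funX; exact: measurable_rvec_coord.
Qed.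

Let prod_pdf (s : 'I_d -> R) t : (forall i, 0 < s i) ->
  \prod_i normal_pdf 0 (s i) (tnth t i) =
  \prod_i (s i * Num.sqrt (pi *+ 2))^-1 *
  expR (- \sum_i (tnth t i / s i) ^+ 2 / 2) :> R.
Proof.
move=> s0; rewrite -sumrN expR_sum -big_split/=; apply: eq_bigr => i _.
have si : s i != 0 by rewrite gt_eqF.
rewrite normal_pdfE// normal_peak_norm gtr0_norm// /normal_fun subr0.
by congr (_ * expR _); field.
Qed.

(** Turns the half-integer powers in the normalizing constants into products over the coordinates,
    to be compared factor by factor with the normal peaks. *)
Let sqrt_pow (x : R) (k : nat) : 0 <= x -> x `^ (k%:R / 2) = Num.sqrt x ^+ k.
Proof. by move=> x0; rewrite mulrC powRrM powR12_sqrt// powR_mulrn ?sqrtr_ge0. Qed.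

Lemma grounded_white_noiseE A : measurable A ->
  grounded_white_noise R n L A = gaussian_comb b sqN_neq0 A.
Proof.
move=> mA; apply: density_gaussian_comb => //.
- apply: measurable_funM => //; apply: measurableT_comp => //.
  by apply: measurable_funM => //; apply: measurable_funX; exact: measurable_enorm.
- by move=> h; rewrite mulr_ge0 ?expR_ge0// invr_ge0 powR_ge0.
- move=> t; rewrite prod_pdf// enorm_comb.
  have -> : \prod_(i < d) (sqN i * Num.sqrt (pi *+ 2))^-1 =
      ((Num.sqrt N%:R * Num.sqrt (pi *+ 2)) ^+ d)^-1 :> R.
    by rewrite -exprVn -[X in _ ^+ X](card_ord d) -prodr_const; apply: eq_bigr.
  congr (_^-1 * expR _).
    rewrite sqrt_pow; last by rewrite !mulr_ge0// pi_ge0.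
    congr (_ ^+ _); rewrite -sqrtrM ?ler0n//; congr Num.sqrt.
    by rewrite -mulr_natl; ring.
  rewrite -sumrN mulr_sumr; apply: eq_bigr => i _.
  by rewrite expr_div_n /sqN sqr_sqrtr ?ltW//; field; rewrite gt_eqF.
Qed.

Lemma nuE A : measurable A -> nu R n L A = gaussian_comb b sig_neq0 A.
Proof.
move=> mA; apply: density_gaussian_comb => //.
- apply: measurable_funM => //; apply: measurableT_comp => //.
  apply: measurable_funM => //; apply: measurable_funX.
  rewrite frac_laplacianE//; apply: measurableT_comp; first exact: measurable_enorm.
  exact: measurable_hartley_multiplier.
- move=> h; rewrite mulr_ge0 ?expR_ge0// /c_ mulr_ge0 ?powR_ge0//.
  by rewrite big_ZL// prodr_ge0// => w _; rewrite powR_ge0.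
- move=> t; rewrite prod_pdf// enorm_frac_comb; congr (_ * expR _).
    rewrite /c_ big_ZL//.
    rewrite (eq_bigr (fun w => eigval w `^ (n%:R / 4))) => [|w _]; last by rewrite lambda_freq_rep.
    rewrite big_freq sqrt_pow; last first.
      by apply: divr_ge0; [exact: ltW|rewrite !mulr_ge0// pi_ge0].
    rewrite -[X in _ ^+ X](card_ord d) -prodr_const -big_split/=.
    apply: eq_bigr => i _; rewrite -/(mu i) /sig.
    have -> : 2 * pi * N%:R = N%:R * (pi *+ 2) :> R by rewrite -mulr_natl; ring.
    have NP0 : 0 <= N%:R * (pi *+ 2) :> R
      by apply: mulr_ge0; [exact: ltW|rewrite mulrn_wge0// pi_ge0].
    rewrite (sqrtrM _ (ltW a0)) (sqrtrV NP0) (sqrtrM _ (ltW N0)).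
    have p0 : Num.sqrt (pi *+ 2) != 0 :> R.
      by rewrite gt_eqF// sqrtr_gt0 mulrn_wgt0// pi_gt0.
    by field; rewrite p0 !gt_eqF//.
  rewrite -sumrN mulr_sumr; apply: eq_bigr => i _; rewrite /sig.
  rewrite expr_div_n expr_div_n exprMn sqr_sqrtr ?ltW// exprMn sqr_sqrtr ?ltW//.
  by field; rewrite !gt_eqF.
Qed.

Lemma nu_probability : exists Q : probability RT R,
  forall A, measurable A -> Q A = nu R n L A.
Proof. by exists (gaussian_comb b sig_neq0) => A mA; rewrite nuE. Qed.

Let bT (i : 'I_d) : RT := (Num.sqrt a * mu i) *: b i.

Lemma Tmap_comb t : Tmap R n L (comb b t) = comb bT t.
Proof.
apply/funext => v; rewrite /Tmap frac_laplacianE//.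
transitivity (Num.sqrt a * (hartley_multiplier (fun x => x `^ (n%:R / 4)) (comb b t) v))=> //.
rewrite combE /hartley_multiplier fct_sumE sum_hartley_freq; last first.
  have /groundedE -> := grounded_comb t.
  by rewrite mulr0 scale0r.
rewrite mulr_sumr; apply: eq_bigr => i _; rewrite dotv_hartley_comb.
transitivity (Num.sqrt a * ((mu i * tnth t i) * b i v)) => //.
transitivity (tnth t i * ((Num.sqrt a * mu i) * b i v)) => //.
by ring.
Qed.

Lemma measurable_Tmap : measurable_fun setT (Tmap R n L : RT -> RT).
Proof.
apply: measurable_rvec => v; rewrite /Tmap frac_laplacianE//.
apply: (@measurable_funM _ _ _ _ (fun=> Num.sqrt a)) => //.
have := measurableT_comp (@measurable_rvec_coord R (torus n L) v)
  (measurable_hartley_multiplier (fun x => x `^ (n%:R / 4))).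
exact.
Qed.

(** [Tmap] stretches [b i] by [Num.sqrt a * mu i], and this factor times [sig i] is [Num.sqrt N%:R];
    so every linear form gets the variance it has under the white noise. *)
Lemma pushforward_nu A : measurable A ->
  pushforward (nu R n L) (Tmap R n L) A = grounded_white_noise R n L A.
Proof.
move=> mA; rewrite grounded_white_noiseE// /pushforward nuE; last first.
  by rewrite -[X in measurable X]setTI; exact: measurable_Tmap.
transitivity (gaussian_comb bT sig_neq0 A).
  rewrite /gaussian_comb /pushforward; congr (gaussian_tuple sig _).
  by apply/seteqP; split=> t; rewrite /preimage/= Tmap_comb.
apply: cramer_wold mA => c B mB.
apply: (etrans (gaussian_comb_dotv bT sig_neq0 c mB)).
apply: (etrans _ (esym (gaussian_comb_dotv b sqN_neq0 c mB))).
congr (normal_prob 0 1 _).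
have -> : \sum_i (dotv c (bT i) * sig i) ^+ 2 = \sum_i (dotv c (b i) * sqN i) ^+ 2.
  apply: eq_bigr => i _; congr (_ ^+ 2).
  have -> : dotv c (bT i) = Num.sqrt a * mu i * dotv c (b i).
    by rewrite /dotv mulr_sumr; apply: eq_bigr => v _; exact: mulrCA.
  by rewrite /sig /sqN; field; rewrite !gt_eqF.
by [].
Qed.

Lemma grounded_Tmap h : grounded R n L (Tmap R n L h).
Proof.
apply/groundedE; rewrite /Tmap frac_laplacianE//.
transitivity (Num.sqrt a * dotv (hartley 0) (hartley_multiplier (fun x => x `^ (n%:R / 4)) h)).
  by rewrite /dotv mulr_sumr; apply: eq_bigr => v _; exact: mulrCA.
by rewrite dotv_hartley_multiplier eigval0 powR0// mul0r mulr0.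
Qed.

Lemma measurable_grounded : measurable (grounded R n L).
Proof.
have mf : measurable_fun setT (fun h : RT => \sum_v h v : mR).
  by apply: measurable_sum => v; exact: measurable_rvec_coord.
have := mf measurableT [set 0] (measurable_set1 _).
by rewrite setTI.
Qed.

Lemma nu_setC_grounded : nu R n L (~` grounded R n L) = 0%E.
Proof.
rewrite nuE; last exact: measurableC measurable_grounded.
rewrite /gaussian_comb /pushforward (_ : _ @^-1` _ = set0) ?measure0//.
by apply/seteqP; split=> // t /=; apply; exact: grounded_comb.
Qed.

Let var (c : RT) : R := \sum_i (dotv c (b i) * sig i) ^+ 2.

Let kLE v u : kL R (v : torus n L) u = \sum_i b i v * b i u * sig i ^+ 2.
Proof.
rewrite kL_hartley// big_freq mulr_sumr; apply: eq_bigr => i _.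
have -> : eigval (freq i) `^ (- (n%:R / 2)) = (mu i ^+ 2)^-1.
  rewrite powRN; congr (_^-1).
  by rewrite -powR_mulrn ?ltW// -powRrM; congr (_ `^ _); field.
rewrite /sig expr_div_n exprMn !sqr_sqrtr ?ltW// /b.
by field; rewrite !gt_eqF.
Qed.

Let varE c : var c = \sum_v \sum_u c v * c u * kL R (v : torus n L) u.
Proof.
transitivity (\sum_i \sum_v \sum_u c v * c u * (b i v * b i u * sig i ^+ 2)).
  apply: eq_bigr => i _; rewrite exprMn expr2 /dotv mulr_suml mulr_suml.
  apply: eq_bigr => v _; rewrite mulr_sumr mulr_suml.
  by apply: eq_bigr => u _; ring.
rewrite exchange_big/=; apply: eq_bigr => v _.
rewrite exchange_big/=; apply: eq_bigr => u _.
by rewrite kLE mulr_sumr.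
Qed.

Let var0 c : 0 <= var c.
Proof. by apply: sumr_ge0 => i _; exact: sqr_ge0. Qed.

Let nu_dotv c (A : set mR) : measurable A ->
  gaussian_comb b sig_neq0 [set h | A (dotv c h)] = gaussian_law 0 (Num.sqrt (var c)) A.
Proof.
move=> mA; apply: (etrans (gaussian_comb_dotv b sig_neq0 c mA)).
rewrite gaussian_lawE//; congr (normal_prob 0 1 _).
by apply/seteqP; split=> z; rewrite /preimage/= add0r.
Qed.

Section field.
Variables (dW : measure_display) (W : measurableType dW) (P : probability W R)
  (X : {RV P >-> RT}).

Let mX c : measurable_fun setT (fun w => dotv c (X w) : mR).
Proof. exact: (measurableT_comp (measurable_dotv c)). Qed.

Let delta (v : torus n L) : RT := fun u => (u == v)%:R.

Let dotv_delta v (h : RT) : dotv (delta v) h = h v.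
Proof.
by rewrite /dotv (bigD1 v)//= /delta eqxx mul1r big1 ?addr0// => u /negbTE ->; rewrite mul0r.
Qed.

Lemma polyharmonic_of_nu :
  (forall A, measurable A -> distribution P X A = nu R n L A) -> polyharmonic_field X.
Proof.
move=> lawX.
have law c (A : set mR) : measurable A ->
    P [set w | A (dotv c (X w))] = gaussian_law 0 (Num.sqrt (var c)) A.
  move=> mA; have mB : measurable [set h : RT | A (dotv c h)].
    by rewrite -[X in measurable X]setTI; exact: measurable_dotv.
  by rewrite -nu_dotv// -nuE// -lawX.
split.
- by move=> c; exists 0, (Num.sqrt (var c)); split; [exact: sqrtr_ge0|exact: law].
- move=> v; rewrite unlock; have [_ + _ _] := gaussian_moments (mX (delta v)) (law (delta v)).
  by under eq_integral do rewrite dotv_delta.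
(* Polarization: the product of two coordinates is a quarter of the difference of the squares of
   their sum and difference, both of which are Gaussian linear forms. *)
- move=> v u; rewrite unlock.
  have [_ _ ip Ep] := gaussian_moments (mX (delta v + delta u)) (law (delta v + delta u)).
  have [_ _ im Em] := gaussian_moments (mX (delta v - delta u)) (law (delta v - delta u)).
  have dD h : dotv (delta v + delta u) h = h v + h u.
    rewrite -(dotv_delta v) -(dotv_delta u h) /dotv -big_split/=.
    by apply: eq_bigr => x _; rewrite [(delta v + delta u) x]/(delta v x + delta u x) mulrDl.
  have dB h : dotv (delta v - delta u) h = h v - h u.
    rewrite -(dotv_delta v) -(dotv_delta u h) /dotv -sumrB/=.
    by apply: eq_bigr => x _; rewrite [(delta v - delta u) x]/(delta v x - delta u x) mulrBl.
  under eq_integral => w _.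
    rewrite (_ : X w v * X w u = 4^-1 * dotv (delta v + delta u) (X w) ^+ 2 -
                 4^-1 * dotv (delta v - delta u) (X w) ^+ 2); last first.
      by rewrite dD dB; field.
    rewrite EFinB !EFinM; over.
  rewrite integralB//=; try exact: integrableZl.
  rewrite !integralZl//= Ep Em -!EFinM -EFinB; congr EFin.
  rewrite !expr0n/= !add0r !sqr_sqrtr ?var0// kLE /var -mulrBr -sumrB mulr_sumr.
  by apply: eq_bigr => i _; rewrite dD dB; field.
Qed.

Lemma nu_of_polyharmonic : polyharmonic_field X ->
  forall A, measurable A -> distribution P X A = nu R n L A.
Proof.
move=> [gX mean cov] A mA; rewrite nuE//.
apply: cramer_wold mA => c B mB.
(* Expanding the moments of a linear form into the given means and covariances requires
   integrability, which is drawn from the Gaussian law of each coordinate; products are then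
   dominated by sums of squares. *)
have intX v : P.-integrable setT (fun w => (X w v)%:E) /\
              P.-integrable setT (fun w => (X w v ^+ 2)%:E).
  have [m [s [_ law]]] := gX (delta v).
  have [i1 _ i2 _] := gaussian_moments (mX (delta v)) law.
  by split; [move: i1|move: i2]; apply: eq_integrable => // w _; rewrite dotv_delta.
have mXv v : measurable_fun setT (fun w => X w v : mR).
  by have := mX (delta v); under eq_fun do rewrite dotv_delta.
have intXX v u : P.-integrable setT (fun w => (X w v * X w u)%:E).
  have i12 : P.-integrable setT (fun w => ((X w v ^+ 2)%:E + (X w u ^+ 2)%:E)%E).
    by apply: integrableD => //; [case: (intX v)|case: (intX u)].
  apply: (le_integrable measurableT _ _ i12).
    by apply/measurable_EFinP; exact: (measurable_funM (mXv v) (mXv u)).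
  move=> w _; rewrite -EFinD lee_fin.
  rewrite [leRHS]ger0_norm ?addr_ge0 ?sqr_ge0//; rewrite ler_norml.
  by have := sqr_ge0 (X w v + X w u); have := sqr_ge0 (X w v - X w u);
     have := sqr_ge0 (X w v); have := sqr_ge0 (X w u); nra.
have [m [s [s0 law]]] := gX c.
have [_ Em _ Es] := gaussian_moments (mX c) law.
have m0 : m = 0.
  apply: EFin_inj; rewrite -Em /dotv.
  under eq_integral do rewrite -sumEFin.
  rewrite integral_sum//=; last first.
    by move=> v; under eq_fun do rewrite EFinM; apply: integrableZl => //; case: (intX v).
  rewrite big1// => v _; under eq_integral do rewrite EFinM.
  rewrite integralZl//=; last by case: (intX v).
  by have := mean v; rewrite unlock => ->; rewrite mule0.
(* The covariances determine only s^2; the sign comes from [0 <= s] in [gaussian_field]. *)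
have sE : s = Num.sqrt (var c).
  suff -> : var c = s ^+ 2 by rewrite sqrtr_sqr ger0_norm.
  apply: EFin_inj; have := Es; rewrite m0 expr0n/= add0r => <-.
  have sq w : dotv c (X w) ^+ 2 = \sum_v \sum_u c v * c u * (X w v * X w u).
    rewrite expr2 /dotv mulr_suml; apply: eq_bigr => v _; rewrite mulr_sumr.
    by apply: eq_bigr => u _; ring.
  under eq_integral do rewrite sq -sumEFin.
  have intvu v u : P.-integrable setT (fun w => (c v * c u * (X w v * X w u))%:E).
    by under eq_fun do rewrite EFinM; exact: integrableZl.
  have intv v : P.-integrable setT (fun w => (\sum_u c v * c u * (X w v * X w u))%:E).
    by under eq_fun do rewrite -sumEFin; exact: integrable_sum.
  rewrite integral_sum//= varE -sumEFin; apply: eq_bigr => v _.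
  under eq_integral do rewrite -sumEFin.
  rewrite integral_sum//= -sumEFin; apply: eq_bigr => u _.
  under eq_integral do rewrite EFinM.
  by rewrite integralZl//= EFinM; have := cov v u; rewrite unlock => ->.
have := law B mB; rewrite m0 sE => h; apply: (etrans h).
by apply/esym; exact: nu_dotv.
Qed.

End field.
End main.

Unset Implicit Arguments.

Theorem theorem2p4 (R : realType) (n L : nat) (n_ge1 : (1 <= n)%N)
    (L_ge1 : (1 <= L)%N) (L_odd : odd L) :
  [/\ (exists Q : probability (rvec R (torus n L)) R,
         forall A : set (rvec R (torus n L)), measurable A -> Q A = nu R n L A),
      nu R n L (~` grounded R n L) = 0%E,
      (forall (d : measure_display) (W : measurableType d)
         (P : probability W R) (X : {RV P >-> rvec R (torus n L)}),
         polyharmonic_field X <->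
         forall A : set (rvec R (torus n L)), measurable A ->
           distribution P X A = nu R n L A),
      (forall h, grounded R n L h -> grounded R n L (Tmap R n L h)) &
      (forall A : set (rvec R (torus n L)), measurable A ->
         pushforward (nu R n L) (Tmap R n L) A = grounded_white_noise R n L A)].
Proof.
case: L L_ge1 L_odd => [//|l] _ L_odd.
have [f [f_inj f_neq0 f_onto]] := nonzero_enum n l.
split.
- exact: (@nu_probability R n l n_ge1 L_odd f f_inj f_neq0 f_onto).
- exact: (@nu_setC_grounded R n l n_ge1 L_odd f f_inj f_neq0 f_onto).
- move=> d W P X; split.
    exact: (@nu_of_polyharmonic R n l n_ge1 L_odd f f_inj f_neq0 f_onto).
  exact: (@polyharmonic_of_nu R n l n_ge1 L_odd f f_inj f_neq0 f_onto).
- by move=> h _; exact: (@grounded_Tmap R n l n_ge1 L_odd).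
- exact: (@pushforward_nu R n l n_ge1 L_odd f f_inj f_neq0 f_onto).
Qed.
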